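(* With $\Sigma,S,\Sigma',S'$ as defined in the context, the Fourier doublets $[S\to\Sigma]\le[S'\to\Sigma']$ are regular subdoublets of $[\mathcal F\colon\mathcal S(\mathbb R)\to\mathcal S(\mathbb R)]$ qua plain doublet: $S\subseteq S'$ are subalgebras of $(\mathcal S(\mathbb R),\star)$, $\Sigma\subseteq\Sigma'$ are subalgebras of $(\mathcal S(\mathbb R),\cdot)$ (over $\mathbb R$ for the unprimed, over $\mathbb C$ for the primed spaces), and $\mathcal F$ restricts to bijections $S\to\Sigma$ and $S'\to\Sigma'$. Moreover, the compatible Weyl action on $[\mathcal F\colon\mathcal S(\mathbb R)\to\mathcal S(\mathbb R)]$ restricts to $[S'\to\Sigma']$.
   Context: $\tau=2\pi$. $\mathcal S(\mathbb R)$ is the space of complex-valued Schwartz functions on $\mathbb R$, $\star$ denotes convolution and $\cdot$ pointwise product; $\mathcal F s(\xi)=\int_{\mathbb R}e^{i\tau x\xi}s(x)\,dx$, with inverse $\mathcal F^\vee$ (negative sign in the exponent). The Heisenberg group is taken to be trivial here, so that a plain doublet $[S\to\Sigma]$ is just an algebra homomorphism from a subalgebra $S$ of $(\mathcal S(\mathbb R),\star)$ to a subalgebra $\Sigma$ of $(\mathcal S(\mathbb R),\cdot)$ obtained by restricting $\mathcal F$; it is regular if bijective. Let $s(t)=\operatorname{sech}(\pi t)$, $c(t)=\operatorname{csch}(\pi t)$, $h(t)=\tanh(\pi t)$, and let $x$ denote the coordinate function. Define $\Sigma:=\mathbb R[s]_+$, the algebra of real polynomials in $s$ without constant term; $S:=\mathbb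 R[x^2]\,s\oplus\mathbb R[x^2]\,x\,c$; $\Sigma':=\mathbb C[x,h][s]_+$, the algebra of polynomials in $s$ without constant term (in $s$) with coefficients in $\mathbb C[x,h]$; $S':=\mathcal F^\vee(\Sigma')\subset\mathcal S(\mathbb R)$. The Weyl algebra $A_1(\mathbb C)$, generated by $x$ and $\partial$ (with $D:=\frac1{i\tau}\partial$), acts on $\mathcal S(\mathbb R)$ by multiplication with $x$ and by differentiation. The action is compatible in the sense that $D$ is a derivation for $\cdot$ and a scalar for $\star$ ($D(a\star b)=(Da)\star b$), $x$ is a scalar for $\cdot$ and a derivation for $\star$, and $\mathcal F(T\cdot f)=\hat{\mathfrak f}(T)\cdot\mathcal F(f)$ for $T\in A_1(\mathbb C)$, where $\hat{\mathfrak f}$ is the automorphism with $x\mapsto D$, $D\mapsto-x$. That it restricts to $[S'\to\Sigma']$ means that $S'$ and $\Sigma'$ are $A_1(\mathbb C)$-submodules of $\mathcal S(\mathbb R)$ (the stated properties being inherited). *)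

(* Defs.v *)
From mathcomp Require Export all_boot all_order all_algebra.
From mathcomp Require Export all_classical all_reals all_analysis.
From mathcomp Require Export complex.
Export numFieldNormedType.Exports.

Set Implicit Arguments.
Unset Strict Implicit.
Unset Printing Implicit Defensive.

Import Order.TTheory GRing.Theory Num.Theory.
Local Open Scope classical_set_scope.
Local Open Scope ring_scope.
Local Open Scope complex_scope.

Section Calculus.
Variable R : realType.
Implicit Types f g : R -> R[i].

(* Differentiation and Lebesgue integration of complex-valued functions of a
   real variable are taken componentwise. *)
Definition cderivable f (t : R) : Prop :=
  derivable (fun u => complex.Re (f u)) t 1 /\
  derivable (fun u => complex.Im (f u)) t 1.

Definition cderiv f : R -> R[i] := fun t =>
  derive1 (fun u => complex.Re (f u)) t +i* derive1 (fun u => complex.Im (f u)) t.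

Definition cderivn (n : nat) f : R -> R[i] := iter n cderiv f.

Definition cintegral f : R[i] :=
  (\int[lebesgue_measure]_(x in setT) complex.Re (f x))%R +i*
  (\int[lebesgue_measure]_(x in setT) complex.Im (f x))%R.

Definition schwartz : set (R -> R[i]) := [set f |
  (forall (n : nat) (t : R), cderivable (cderivn n f) t) /\
  (forall m n : nat, exists M : R, forall t : R,
     `|t| ^+ m * Normc.normc (cderivn n f t) <= M)].

Definition tau : R := 2 * pi.

Definition cis (theta : R) : R[i] := cos theta +i* sin theta.

Definition fourier f : R -> R[i] := fun xi =>
  cintegral (fun x => cis (tau * x * xi) * f x).

Definition fourier_inv f : R -> R[i] := fun xi =>
  cintegral (fun x => cis (- (tau * x * xi)) * f x).

Definition conv f g : R -> R[i] := fun x =>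
  cintegral (fun y => f y * g (x - y)).

Definition pmul f g : R -> R[i] := f \* g.

End Calculus.

Section Doublets.
Variable R : realType.

(* Subalgebras are not unital. The ground ring K acts through iota, so that
   algebras over R and over C are treated alike. *)
Definition subalgebra (K : pzRingType) (iota : K -> R[i])
    (mul : (R -> R[i]) -> (R -> R[i]) -> R -> R[i])
    (A : set (R -> R[i])) : Prop :=
  [/\ A `<=` @schwartz R,
      A (fun=> 0),
      forall f g, A f -> A g -> A (f \+ g),
      forall (a : K) f, A f -> A (iota a \*o f) &
      forall f g, A f -> A g -> A (mul f g)].

Definition plain_doublet (K : pzRingType) (iota : K -> R[i])
    (A B : set (R -> R[i])) : Prop :=
  [/\ subalgebra iota (@conv R) A,
      subalgebra iota (@pmul R) B &
      [/\ set_fun A B (@fourier R),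
          forall f g, A f -> A g -> fourier (f \+ g) = fourier f \+ fourier g,
          forall (a : K) f, A f ->
            fourier (iota a \*o f) = iota a \*o fourier f &
          forall f g, A f -> A g ->
            fourier (conv f g) = pmul (fourier f) (fourier g)]].

Definition regular_doublet (K : pzRingType) (iota : K -> R[i])
    (A B : set (R -> R[i])) : Prop :=
  plain_doublet iota A B /\ set_bij A B (@fourier R).

End Doublets.

Section Weyl.
Variable R : realType.
Implicit Types f g : R -> R[i].

(* Expressions in the generators x and d/dx with complex scalars; they denote
   the elements of the Weyl algebra A_1(C), and the action and the Fourier
   automorphism below are defined on representatives. *)
Inductive weyl : Type :=
  | WX
  | Wd
  | WC of R[i]
  | WAdd of weyl & weyl
  | WMul of weyl & weyl.

Definition itau : R[i] := 0 +i* tau R.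

Definition WD : weyl := WMul (WC itau^-1) Wd.

Fixpoint wact (T : weyl) : (R -> R[i]) -> R -> R[i] :=
  match T with
  | WX => fun f t => t%:C * f t
  | Wd => fun f => cderiv f
  | WC c => fun f => c \*o f
  | WAdd T1 T2 => fun f => wact T1 f \+ wact T2 f
  | WMul T1 T2 => fun f => wact T1 (wact T2 f)
  end.

(* d/dx = (i tau) D is sent to - (i tau) x. *)
Fixpoint wfourier (T : weyl) : weyl :=
  match T with
  | WX => WD
  | Wd => WMul (WC (- itau)) WX
  | WC c => WC c
  | WAdd T1 T2 => WAdd (wfourier T1) (wfourier T2)
  | WMul T1 T2 => WMul (wfourier T1) (wfourier T2)
  end.

Definition weyl_submodule (A : set (R -> R[i])) : Prop :=
  [/\ A `<=` @schwartz R,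
      A (fun=> 0),
      forall f g, A f -> A g -> A (f \+ g) &
      forall (T : weyl) f, A f -> A (wact T f)].

Definition compatible_weyl_action (A B : set (R -> R[i])) : Prop :=
  [/\ weyl_submodule A,
      weyl_submodule B,
      (forall f g, B f -> B g ->
         wact WD (pmul f g) = pmul (wact WD f) g \+ pmul f (wact WD g) /\
         wact WX (pmul f g) = pmul (wact WX f) g),
      (forall f g, A f -> A g ->
         wact WD (conv f g) = conv (wact WD f) g /\
         wact WX (conv f g) = conv (wact WX f) g \+ conv f (wact WX g)) &
      forall (T : weyl) f, A f ->
        fourier (wact T f) = wact (wfourier T) (fourier f)].

End Weyl.

Section HyperbolicSpaces.
Variable R : realType.

Definition sinh (t : R) : R := (expR t - expR (- t)) / 2.
Definition cosh (t : R) : R := (expR t + expR (- t)) / 2.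

Definition s_fun (t : R) : R := (cosh (pi * t))^-1.
Definition h_fun (t : R) : R := sinh (pi * t) / cosh (pi * t).

(* The function x * csch(pi x), extended by continuity at its removable
   singularity 0 (where division by zero would give the wrong value 0). *)
Definition xc_fun (t : R) : R :=
  if t == 0 then pi^-1 else t * (sinh (pi * t))^-1.

(* R[s]_+ (p`_0 is the constant term), as complex-valued functions. *)
Definition Sigma_R : set (R -> R[i]) := [set f |
  exists p : {poly R}, p`_0 = 0 /\ f = (fun t => (p.[s_fun t])%:C)].

(* R[x^2] s (+) R[x^2] x c, as complex-valued functions. *)
Definition S_R : set (R -> R[i]) := [set f |
  exists p q : {poly R},
    f = (fun t => (p.[t ^+ 2] * s_fun t + q.[t ^+ 2] * xc_fun t)%:C)].

(* C[x,h][s]_+ : the outermost polynomial variable is evaluated at s, the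
   middle one at h, the innermost one at x; p`_0 is the part constant in s. *)
Definition Sigma_C : set (R -> R[i]) := [set f |
  exists p : {poly {poly {poly R[i]}}}, p`_0 = 0 /\
    f = (fun t => p.[(s_fun t)%:C%:P%:P].[(h_fun t)%:C%:P].[t%:C])].

Definition S_C : set (R -> R[i]) := @fourier_inv R @` Sigma_C.

End HyperbolicSpaces.

(* Main.v *)
(* Write * for convolution, and F for the Fourier transform.

   The transform of s. The integral s * s = 2 x c has an elementary
   antiderivative, and (x c) * s = (1/4 + x^2) s reduces to it by the substitution
   y -> x - y, so that s * s * s = (1/2 + 2 x^2) s. Applying F, and since F turns x into
   (1 / (i tau)) d/dx, the function g = F s satisfies
   g'' = pi^2 (g - 2 g^3), g(0) = 1 and g'(0) = 0. As s solves the same initial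
   value problem, F s = s. Then F (2 x c) = F s . F s = s^2, and Fubini's theorem
   gives F^v (s^2) = F^v (F s . s) = s * F^v s = 2 x c.

   Inversion. F o F^v commutes with x and d/dx, fixes s and s^2, and Sigma_C is
   generated by s and s^2 over the Weyl algebra; so F o F^v is the identity of
   Sigma_C, and no general inversion theorem is needed. The convolution theorem
   on S_C then follows from f * F^v b = F^v (F f . b).

   The real doublet. F turns x^2 into - (1 / tau^2) (d/dx)^2, which maps R[s]_+ to
   itself, and s^(n+2) is a combination of s^n and (s^n)''. *)
Require Import Defs.
From mathcomp Require Import measurable_realfun ring lra.
Local Open Scope classical_set_scope.
Local Open Scope ring_scope.
Local Open Scope complex_scope.

Set Implicit Arguments.
Unset Strict Implicit.
Unset Printing Implicit Defensive.

Import Order.TTheory GRing.Theory Num.Theory.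

(** * Lebesgue integrals on the real line *)

(** The equation for g = F s is nonlinear, but g is only compared with one known solution: w = g - s
    satisfies w'' = q w with q = pi^2 (1 - 2 (g^2 + g s + s^2)), and q is bounded because g is the
    transform of an integrable function. Both convolution integrals rest on addition formulas: s(y)
    s(x - y) sinh(pi x) is a sum of two tanh, and x c times a translate of s splits off the same
    sum. The constant 1/4 is the integral of [xc (2 * y)], which comes from F (s * s) = (F s)^2 read
    at frequency 0. The analysis runs on one weight: a bound on (1 + t^2) |f(t)| gives integrability
    and the dominating functions for differentiation under the integral and for Fubini. That S is
    closed under convolution and that the Weyl generators act correctly on convolutions is never
    computed on integrals; both are pulled back from pointwise products along F, which is injective
    on S'. *)

Section RealIntegrals.
Variable R : realType.
Implicit Types (f g F G : R -> R) (t x y c M : R).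
Let mu := @lebesgue_measure R.

Definition rintegrable f := mu.-integrable setT (EFin \o f).

Lemma integrable_oneDsqrV : rintegrable (fun t => (1 + t ^+ 2)^-1).
Proof.
apply/integrableP; split.
  apply/measurable_EFinP; apply: continuous_measurable_fun.
  exact: (@continuous_oneDsqrV R).
rewrite (_ : (fun x => _) = (fun x => ((oneDsqr x)^-1)%:E)); last first.
  apply/funext => t /=; rewrite ger0_norm// invr_ge0 addr_ge0 ?sqr_ge0//.
rewrite ge0_symfun_integralT.
- by rewrite -set_itvcy integral0y_oneDsqr -EFinM ltry.
- by move=> t; rewrite invr_ge0 /oneDsqr addr_ge0 ?sqr_ge0.
- exact: continuous_oneDsqrV.
- by move=> t; rewrite /= /oneDsqr sqrrN.
Qed.

Lemma le_oneDsqrV_rintegrable f M : measurable_fun setT f ->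
  (forall t, (1 + t ^+ 2) * `|f t| <= M) -> rintegrable f.
Proof.
move=> mf fM.
have := integrableZl measurableT M integrable_oneDsqrV.
apply: le_integrable => //; first exact/measurable_EFinP.
move=> t _ /=; rewrite lee_fin.
have t0 : 0 < 1 + t ^+ 2 by rewrite ltr_pwDl ?sqr_ge0.
apply: le_trans (ler_norm _).
by rewrite ler_pdivlMr// mulrC.
Qed.

(** Dominated convergence for truncations to growing symmetric intervals, with [|f|] itself as the
    bound. The limit at minus infinity is stated for [F (- x)], so that one filter serves both
    ends. *)
Lemma integralT_FTC f F (l m : R) : continuous f -> rintegrable f ->
  (forall t, is_derive t 1 F (f t)) ->
  F x @[x --> +oo] --> l -> F (- x) @[x --> +oo] --> m ->
  \int[mu]_x f x = l - m.
Proof.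
move=> cf intf dF Fl Fm.
have cF : continuous F.
  by move=> x; apply/differentiable_continuous/derivable1_diffP/ex_derive.
(* [n.+1] keeps the endpoints distinct, as the fundamental theorem on an interval requires. *)
pose I (n : nat) : set R := [set` `[- n.+1%:R, n.+1%:R]].
have If n : (\int[mu]_x (((EFin \o f) \_ (I n)) x) =
    (F n.+1%:R - F (- n.+1%:R))%:E)%E.
  rewrite -integral_mkcond (@continuous_FTC2 _ f F) ?EFinB//.
  - by rewrite (@lt_trans _ _ 0)// oppr_lt0.
  - exact: continuous_subspaceT.
  - split; first by move=> x _; exact: ex_derive.
      exact/cvg_at_right_filter/cF.
    exact/cvg_at_left_filter/cF.
  - by move=> x _; rewrite derive1E; exact: derive_val.
have mf : measurable_fun setT (EFin \o f) by exact: measurable_int intf.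
have /fine_cvg L : (\int[mu]_x (((EFin \o f) \_ (I n)) x))%E @[n --> \oo] -->
    (\int[mu]_x f x)%:E.
  rewrite /Rintegral fineK; last exact: integrable_fin_num.
  apply: (@dominated_cvg _ _ _ mu _ measurableT
    (fun n => (EFin \o f) \_ (I n)) _ (fun x => `|(f x)%:E|%E)).
  - move=> n; apply/measurable_restrict; [exact: measurable_itv|by []|].
    exact: measurable_funTS.
  - move=> x _; apply: cvg_near_cst; near=> n.
    rewrite patchE mem_set//= /I /= in_itv /= -ler_norml.
    apply: (@le_trans _ _ n%:R); last by rewrite ler_nat.
    near: n; exact: nbhs_infty_ger.
  - by [].
  - exact: integrable_abse.
  - move=> n x _; rewrite patchE; case: ifP => //.
    by rewrite abse0.
rewrite -[LHS]/(fine (\int[mu]_x f x)%:E).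
apply: (@cvg_unique _ _ (F n.+1%:R - F (- n.+1%:R) @[n --> \oo])) => //.
  by apply: cvg_trans L; apply: near_eq_cvg; apply: nearW => n; rewrite /= If.
have N1 : (n.+1%:R : R) @[n --> \oo] --> +oo.
  by have := @cvgr_idn R; rewrite -(cvg_shiftS (fun n => n%:R : R)).
apply: cvgB; first exact: (cvg_comp _ _ N1 Fl).
exact: (cvg_comp _ _ N1 Fm).
Unshelve. all: by end_near. Qed.

Lemma ge0_integral_affine G (a b : R) : 0 < a -> continuous G -> (forall x, 0 <= G x) ->
  (\int[mu]_x (G x)%:E = \int[mu]_x (G (a * x + b) * a)%:E)%E.
Proof.
move=> a0 cG G0.
have dF (x : R) : is_derive x 1 (fun x => a * x + b) a.
  by apply: is_derive_eq; rewrite /= addr0 scaler1 /GRing.scale/= ?mulr1.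
have dFE : derive1 (fun x => a * x + b) = cst a.
  by apply/funext => x; rewrite derive1E derive_val.
rewrite (@increasing_ge0_integration_by_substitutionT _ (fun x => a * x + b))//.
- by apply: eq_integral => x _; rewrite dFE.
- by move=> x y xy; rewrite ltrD2r ltr_pM2l.
- by rewrite dFE; exact: cst_continuous.
- by rewrite dFE; exact: is_cvg_cst.
- by rewrite dFE; exact: is_cvg_cst.
- apply/cvgrNyPle => A.
  apply: filterS (nbhs_ninfty_le (num_real ((A - b) / a))) => x xA.
  by rewrite -lerBrDr mulrC -ler_pdivlMr.
- apply/cvgryPge => A.
  apply: filterS (nbhs_pinfty_ge (num_real ((A - b) / a))) => x xA.
  by rewrite -lerBlDr mulrC -ler_pdivrMr.
Qed.

(** Each side is the sum of the integrals of [G x] and [G (- x)] over the nonnegative half-line;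
    reflection exchanges the two terms. *)
Lemma ge0_integral_oppr G : continuous G -> (forall x, 0 <= G x) ->
  (\int[mu]_x (G x)%:E = \int[mu]_x (G (- x))%:E)%E.
Proof.
have split G1 : continuous G1 -> (forall x, 0 <= G1 x) ->
    (\int[mu]_x (G1 x)%:E = \int[mu]_(x in `[0%R, +oo[) (G1 x)%:E +
                             \int[mu]_(x in `[0%R, +oo[) (G1 (- x)%R)%:E)%E.
  move=> cG G0.
  have mG : measurable_fun [set: R] G1 by exact: continuous_measurable_fun.
  have mposnums : measurable [set x : R | 0 <= x]%R by rewrite -set_itvcy.
  rewrite -(setUv [set x : R | 0 <= x]%R) ge0_integral_setU//=; last 4 first.
    exact: measurableC.
    by apply/measurable_EFinP; rewrite setUv.
    by move=> x _; rewrite lee_fin.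
    exact/disj_setPCl.
  rewrite -set_itvcy// setCitvr; congr +%E.
  rewrite integral_itv_bndo_bndc; last exact/measurable_EFinP/measurable_funTS.
  rewrite -{1}oppr0 ge0_integration_by_substitutionNy//.
  exact: continuous_subspaceT.
move=> cG G0.
rewrite split// [RHS]split//; last first.
  by move=> x; apply: continuous_comp; [exact: oppr_continuous|exact: cG].
by rewrite addeC; congr +%E; apply: eq_integral => x _; rewrite opprK.
Qed.

Lemma continuous_max0 G : continuous G -> continuous (fun x => Num.max (G x) 0).
Proof.
move=> cG x.
rewrite (_ : (fun x => _) = (fun x => (G x + `|G x|) / 2)).
  apply: cvgMl; apply: cvgD; first exact: cG.
  by apply: cvg_norm; exact: cG.
by apply/funext => y; rewrite maxr_absE; congr (_ / _); rewrite subr0 addr0.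
Qed.

(** The substitution is made in the positive and negative parts separately, where the integrand is
    nonnegative and still continuous; the factor [a > 0] passes through the maximum with 0. *)
Lemma Rintegral_affine G (a b : R) : 0 < a -> continuous G ->
  \int[mu]_x G x = \int[mu]_x (G (a * x + b) * a).
Proof.
move=> a0 cG; congr fine.
rewrite integralE [RHS]integralE; congr (_ - _)%E.
  transitivity (\int[mu]_x (Num.max (G x) 0)%:E)%E.
    by apply: eq_integral => x _; rewrite funeposE EFin_max.
  rewrite (ge0_integral_affine b a0 (continuous_max0 cG)).
    apply: eq_integral => x _; rewrite funeposE -EFin_max maxr_pMl ?ltW//.
    by rewrite mul0r.
  by move=> x; rewrite le_max lexx orbT.
transitivity (\int[mu]_x (Num.max (- G x) 0)%:E)%E.
  by apply: eq_integral => x _; rewrite funenegE EFin_max.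
have cNG : continuous (fun x => - G x) by move=> x; apply: cvgN; exact: cG.
rewrite (ge0_integral_affine b a0 (continuous_max0 cNG)).
  apply: eq_integral => x _; rewrite funenegE -EFinN -EFin_max maxr_pMl ?ltW//.
  by rewrite mul0r mulNr.
by move=> x; rewrite le_max lexx orbT.
Qed.

Lemma Rintegral_oppr G : continuous G ->
  \int[mu]_x G x = \int[mu]_x G (- x).
Proof.
move=> cG; congr fine.
rewrite integralE [RHS]integralE; congr (_ - _)%E.
  transitivity (\int[mu]_x (Num.max (G x) 0)%:E)%E.
    by apply: eq_integral => x _; rewrite funeposE EFin_max.
  rewrite (ge0_integral_oppr (continuous_max0 cG)).
    by apply: eq_integral => x _; rewrite funeposE EFin_max.
  by move=> x; rewrite le_max lexx orbT.
transitivity (\int[mu]_x (Num.max (- G x) 0)%:E)%E.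
  by apply: eq_integral => x _; rewrite funenegE EFin_max.
have cNG : continuous (fun x => - G x) by move=> x; apply: cvgN; exact: cG.
rewrite (ge0_integral_oppr (continuous_max0 cNG)).
  by apply: eq_integral => x _; rewrite funenegE EFin_max.
by move=> x; rewrite le_max lexx orbT.
Qed.

Lemma Rintegral_subr G c : continuous G ->
  \int[mu]_x G x = \int[mu]_x G (x - c).
Proof.
move=> cG; rewrite (Rintegral_affine (- c) ltr01 cG).
by apply: eq_Rintegral => x _; rewrite mul1r mulr1.
Qed.

Lemma Rintegral_rsubr G c : continuous G ->
  \int[mu]_x G x = \int[mu]_x G (c - x).
Proof.
move=> cG; rewrite Rintegral_oppr// (@Rintegral_subr (fun x => G (- x)) c).
  by apply: eq_Rintegral => x _; rewrite opprB.
by move=> x; apply: continuous_comp; [exact: oppr_continuous|exact: cG].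
Qed.

End RealIntegrals.

Section RealIntegrals2.
Variable R : realType.
Let mu := @lebesgue_measure R.

(** The bound M / (1 + y^2) on the partial derivative is uniform in the parameter, so the radius 1
    of the interval around [x] is arbitrary. *)
Lemma is_derive_under_integral (f df : R -> R -> R) (M x : R) :
  (forall x, rintegrable (f x)) ->
  (forall x1 y : R, is_derive x1 (1 : R) (f ^~ y) (df x1 y)) ->
  (forall x y, (1 + y ^+ 2) * `|df x y| <= M) ->
  is_derive x 1 (fun x => \int[mu]_y f x y) (\int[mu]_y df x y).
Proof.
move=> intf dfE dfM.
have d1E x1 y : partial1of2 f x1 y = df x1 y.
  by rewrite partial1of2E; exact: derive_val.
have xI : `]x - 1, x + 1[%classic x by rewrite /= in_itv/= ltrBlDr ltrDl ltr01.
have M0 : 0 <= M.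
  apply: le_trans (dfM 0 0); rewrite mulr_ge0// addr_ge0// sqr_ge0//.
have G0 y : 0 <= M * (1 + y ^+ 2)^-1.
  by rewrite mulr_ge0// invr_ge0 addr_ge0// sqr_ge0.
have intG : mu.-integrable setT (EFin \o (fun y => M * (1 + y ^+ 2)^-1)).
  exact: (integrableZl measurableT M (@integrable_oneDsqrV R)).
have Gub x1 y : `]x - 1, x + 1[%classic x1 -> [set: R] y ->
    `|partial1of2 f x1 y| <= M * (1 + y ^+ 2)^-1.
  move=> _ _; rewrite d1E ler_pdivlMr ?ltr_pwDl ?sqr_ge0// mulrC.
  exact: dfM.
have der x1 y : `]x - 1, x + 1[%classic x1 -> [set: R] y ->
  derivable (f ^~ y) x1 1 by move=> _ _; exact: ex_derive.
have := @derivable_under_integral R _ _ mu f setT measurableT x (x - 1) (x + 1)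
  xI (fun x _ => intf x) der _ G0 intG Gub.
have := @differentiation_under_integral R _ _ mu f setT measurableT x (x - 1) (x + 1)
  xI (fun x _ => intf x) der _ G0 intG Gub.
rewrite derive1E => E D.
apply: DeriveDef => //; rewrite E; apply: eq_Rintegral => y _.
exact: d1E.
Qed.

(** The kernel is dominated by a product of two integrable weights, hence integrable on the product
    space by Tonelli. [int1] and [int2] make the inner integrals finite, which is what passing
    through [fine] requires. *)
Lemma Rintegral_Fubini (k : R * R -> R) (M : R) : measurable_fun setT k ->
  (forall x y, (1 + x ^+ 2) * (1 + y ^+ 2) * `|k (x, y)| <= M) ->
  \int[mu]_x \int[mu]_y k (x, y) = \int[mu]_y \int[mu]_x k (x, y).
Proof.
move=> mk kM.
have s0 (t : R) : 0 < 1 + t ^+ 2 by rewrite ltr_pwDl ?sqr_ge0.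
have s1 (t : R) : 1 <= 1 + t ^+ 2 by rewrite lerDl sqr_ge0.
have M0 : 0 <= M.
  by apply: le_trans (kM 0 0); rewrite !mulr_ge0// ltW.
have int1 x : rintegrable (fun y => k (x, y)).
  apply: (@le_oneDsqrV_rintegrable _ _ M); first exact: measurableT_comp.
  move=> y; apply: le_trans (kM x y).
  by rewrite -mulrA ler_peMl// mulr_ge0// ltW.
have int2 y : rintegrable (fun x => k (x, y)).
  apply: (@le_oneDsqrV_rintegrable _ _ M); first exact: measurableT_comp.
  move=> x; apply: le_trans (kM x y).
  by rewrite mulrAC ler_peMr// mulr_ge0// ltW.
pose w (t : R) := (1 + t ^+ 2)^-1.
have w0 t : 0 <= w t by rewrite invr_ge0 ltW.
have iw : rintegrable w by exact: integrable_oneDsqrV.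
have wfin : (\int[mu]_t (w t)%:E \is a fin_num)%E by exact: integrable_fin_num.
have ik : (mu \x mu)%E.-integrable setT (EFin \o k).
  apply/integrable12ltyP; first exact/measurable_EFinP.
  apply: (@le_lt_trans _ _ (\int[mu]_x \int[mu]_y (M * w x * w y)%:E)%E).
    apply: ge0_le_integral => //.
    - by move=> x _; exact: integral_ge0.
    - apply: (@measurable_fun_fubini_tonelli_F _ _ _ _ _ mu (fun z => `|(k z)%:E|)%E) => //.
      by apply: measurableT_comp => //; exact/measurable_EFinP.
    - apply: (@measurable_fun_fubini_tonelli_F _ _ _ _ _ mu
        (fun z => (M * w z.1 * w z.2)%:E)%E) => //;
        last by move=> z; rewrite lee_fin !mulr_ge0.
      apply/measurable_EFinP.
      have mw : measurable_fun [set: R] w.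
        by apply: continuous_measurable_fun; exact: (@continuous_oneDsqrV R).
      apply: measurable_funM; last exact: measurableT_comp.
      by apply: measurable_funM => //; exact: measurableT_comp.
    - move=> x _; apply: ge0_le_integral => //.
      + apply: measurableT_comp => //; exact: measurable_int (int1 x).
      + apply: measurable_int; exact: (integrableZl measurableT (M * w x) iw).
      + move=> y _; rewrite /= lee_fin /w -mulrA -invfM ler_pdivlMr ?mulr_gt0//.
        by rewrite mulrC; exact: kM.
  under eq_integral do (under eq_integral do rewrite EFinM; rewrite integralZl//).
  rewrite -(fineK wfin).
  under eq_integral do rewrite -EFinM -mulrA mulrC -mulrA mulrC EFinM.
  rewrite (integralZl measurableT iw).
  by rewrite -(fineK wfin) -EFinM ltry.
rewrite /Rintegral.
transitivity (fine (\int[mu]_x \int[mu]_y (k (x, y))%:E)%E).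
  congr fine; apply: eq_integral => x _; rewrite fineK//.
  exact: (integrable_fin_num _ (int1 x)).
rewrite (Fubini ik).
congr fine; apply: eq_integral => x _; rewrite fineK//.
exact: (integrable_fin_num _ (int2 x)).
Qed.

End RealIntegrals2.

(** * Calculus of complex-valued functions *)

Section ComplexCalculus.
Variable R : realType.
Implicit Types (f g h : R -> R[i]) (t x y k : R) (z w : R[i]).
Let mu := @lebesgue_measure R.
Local Notation Re := complex.Re.
Local Notation Im := complex.Im.
Local Notation normc := Normc.normc.

Lemma complex_ReM z w : Re (z * w) = Re z * Re w - Im z * Im w.
Proof. by case: z w => [a b] [c d]. Qed.

Lemma complex_ImM z w : Im (z * w) = Re z * Im w + Im z * Re w.
Proof. by case: z w => [a b] [c d]. Qed.

Lemma complex_ReD z w : Re (z + w) = Re z + Re w.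
Proof. by case: z w => [a b] [c d]. Qed.

Lemma complex_ImD z w : Im (z + w) = Im z + Im w.
Proof. by case: z w => [a b] [c d]. Qed.

Lemma complex_ext z w : Re z = Re w -> Im z = Im w -> z = w.
Proof. by case: z w => [a b] [c d] /= -> ->. Qed.

Lemma normr_Re_le z : `|Re z| <= normc z.
Proof. by case: z => a b /=; rewrite -sqrtr_sqr ler_wsqrtr// lerDl sqr_ge0. Qed.

Lemma normr_Im_le z : `|Im z| <= normc z.
Proof. by case: z => a b /=; rewrite -sqrtr_sqr ler_wsqrtr// lerDr sqr_ge0. Qed.

Lemma normc_ge0 z : 0 <= normc z.
Proof. by case: z => a b; exact: sqrtr_ge0. Qed.

Lemma normc_real x : normc x%:C = `|x|.
Proof. by rewrite /= expr0n addr0 sqrtr_sqr. Qed.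

Lemma normc_le_ReIm z : normc z <= `|Re z| + `|Im z|.
Proof.
rewrite {1}[z]complexE; apply: le_trans (le_normcD _ _) _.
by rewrite Normc.normcM !normc_real /= expr0n expr1n add0r sqrtr1 mul1r.
Qed.

Lemma normc_cis x : normc (cis x) = 1.
Proof. by rewrite /= cos2Dsin2 sqrtr1. Qed.

Lemma cisD x y : cis (x + y) = cis x * cis y.
Proof. by apply: complex_ext; rewrite /= ?cosD ?sinD// addrC mulrC [X in _ + X]mulrC. Qed.

(** A relational form of [cderiv]: it carries differentiability along with the derivative, so that
    the rules compose. *)
Definition is_cderiv f g := forall t,
  is_derive t (1 : R) (fun u => Re (f u)) (Re (g t)) /\
  is_derive t (1 : R) (fun u => Im (f u)) (Im (g t)).

Lemma is_cderiv_cderivable f g t : is_cderiv f g -> cderivable f t.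
Proof. by move=> /(_ t)[? ?]; split; exact: ex_derive. Qed.

Lemma is_cderiv_cderiv f g : is_cderiv f g -> cderiv f = g.
Proof.
move=> fg; apply/funext => t; have [d1 d2] := fg t.
by apply: complex_ext; rewrite /= derive1E; exact: derive_val.
Qed.

Lemma is_cderiv_ext f g h : is_cderiv f g -> g =1 h -> is_cderiv f h.
Proof. by move=> fg /funext <-. Qed.

Lemma is_cderiv_cst z : is_cderiv (fun=> z) (fun=> 0).
Proof. by move=> t; split; exact: is_derive_cst. Qed.

Lemma is_cderiv_real (f g : R -> R) : (forall t, is_derive t (1 : R) f (g t)) ->
  is_cderiv (fun t => (f t)%:C) (fun t => (g t)%:C).
Proof. by move=> fg t; split => //=; exact: is_derive_cst. Qed.

Lemma is_cderivD f f' g g' : is_cderiv f f' -> is_cderiv g g' ->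
  is_cderiv (fun t => f t + g t) (fun t => f' t + g' t).
Proof.
move=> ff' gg' t; have [f1 f2] := ff' t; have [g1 g2] := gg' t.
split.
  under eq_fun do rewrite complex_ReD.
  by rewrite complex_ReD; exact: is_deriveD.
under eq_fun do rewrite complex_ImD.
by rewrite complex_ImD; exact: is_deriveD.
Qed.

Lemma is_cderivM f f' g g' : is_cderiv f f' -> is_cderiv g g' ->
  is_cderiv (fun t => f t * g t) (fun t => f' t * g t + f t * g' t).
Proof.
move=> ff' gg' t; have [f1 f2] := ff' t; have [g1 g2] := gg' t.
split.
  under eq_fun do rewrite complex_ReM.
  apply: is_derive_eq; rewrite complex_ReD !complex_ReM /GRing.scale/=; ring.
under eq_fun do rewrite complex_ImM.
apply: is_derive_eq; rewrite complex_ImD !complex_ImM /GRing.scale/=; ring.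
Qed.

Lemma is_cderivZ z f f' : is_cderiv f f' ->
  is_cderiv (fun t => z * f t) (fun t => z * f' t).
Proof.
move=> ff'; apply: is_cderiv_ext (is_cderivM (is_cderiv_cst z) ff') _ => t /=.
by rewrite mul0r add0r.
Qed.

Lemma is_cderiv_cis k : is_cderiv (fun t => cis (k * t)) (fun t => (0 +i* k) * cis (k * t)).
Proof.
move=> t; split => /=; apply: is_derive_eq; rewrite /GRing.scale/=; ring.
Qed.

Definition ccontinuous f := continuous (fun t => Re (f t)) /\ continuous (fun t => Im (f t)).

Lemma is_cderiv_continuous f g : is_cderiv f g -> ccontinuous f.
Proof.
move=> fg; split=> t; have [d1 d2] := fg t;
  by apply/differentiable_continuous/derivable1_diffP; exact: ex_derive.
Qed.

Lemma ccontinuousM f g : ccontinuous f -> ccontinuous g -> ccontinuous (fun t => f t * g t).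
Proof.
move=> [f1 f2] [g1 g2]; split => t.
  under eq_fun do rewrite complex_ReM.
  by apply: cvgB; apply: cvgM; [exact: f1|exact: g1|exact: f2|exact: g2].
under eq_fun do rewrite complex_ImM.
by apply: cvgD; apply: cvgM; [exact: f1|exact: g2|exact: f2|exact: g1].
Qed.

Lemma ccontinuous_real (f : R -> R) : continuous f -> ccontinuous (fun t => (f t)%:C).
Proof. by move=> cf; split => //= t; exact: cvg_cst. Qed.

Lemma ccontinuous_cis k : ccontinuous (fun t => cis (k * t)).
Proof. exact: is_cderiv_continuous (is_cderiv_cis k). Qed.

Definition cmeasurable d (T : measurableType d) (f : T -> R[i]) :=
  measurable_fun setT (fun a => Re (f a)) /\ measurable_fun setT (fun a => Im (f a)).

Lemma ccontinuous_measurable f : ccontinuous f -> cmeasurable f.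
Proof. by move=> [f1 f2]; split; exact: continuous_measurable_fun. Qed.

Lemma cmeasurableM d (T : measurableType d) (f g : T -> R[i]) :
  cmeasurable f -> cmeasurable g -> cmeasurable (fun a => f a * g a).
Proof.
move=> [f1 f2] [g1 g2]; split.
  under eq_fun do rewrite complex_ReM.
  by apply: measurable_funB; exact: measurable_funM.
under eq_fun do rewrite complex_ImM.
by apply: measurable_funD; exact: measurable_funM.
Qed.

Lemma cmeasurableD d (T : measurableType d) (f g : T -> R[i]) :
  cmeasurable f -> cmeasurable g -> cmeasurable (fun a => f a + g a).
Proof.
move=> [f1 f2] [g1 g2]; split.
  by under eq_fun do rewrite complex_ReD; exact: measurable_funD.
by under eq_fun do rewrite complex_ImD; exact: measurable_funD.
Qed.

Lemma cmeasurable_comp d d' (T : measurableType d) (T' : measurableType d')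
  (u : T' -> T) (f : T -> R[i]) :
  cmeasurable f -> measurable_fun setT u -> cmeasurable (fun a => f (u a)).
Proof.
by move=> [f1 f2] mu'; split; [exact: (measurableT_comp f1)|exact: (measurableT_comp f2)].
Qed.

Lemma cmeasurable_cst d (T : measurableType d) z : cmeasurable (fun _ : T => z).
Proof. by split; exact: measurable_cst. Qed.

Lemma cmeasurable_cis d (T : measurableType d) (u : T -> R) :
  measurable_fun setT u -> cmeasurable (fun a => cis (u a)).
Proof.
move=> m; apply: (cmeasurable_comp (f := @cis R)) => //.
apply: ccontinuous_measurable.
by have := ccontinuous_cis 1; under eq_fun do rewrite mul1r.
Qed.

(** The bound stays explicit because differentiation under the integral needs one [M] for a whole
    family of functions. *)
Definition decays f (M : R) := forall t, (1 + t ^+ 2) * normc (f t) <= M.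

Definition tame f := cmeasurable f /\ exists M, decays f M.

Definition cintegrable f :=
  rintegrable (fun t => Re (f t)) /\ rintegrable (fun t => Im (f t)).

Lemma oneDsqr_gt0 t : 0 < 1 + t ^+ 2.
Proof. by rewrite ltr_pwDl ?sqr_ge0. Qed.

Lemma tame_integrable f : tame f -> cintegrable f.
Proof.
move=> [[m1 m2] [M fM]]; split.
  apply: (le_oneDsqrV_rintegrable (M := M)) => // t.
  by apply: le_trans (fM t); rewrite ler_wpM2l ?normr_Re_le// ltW// oneDsqr_gt0.
apply: (le_oneDsqrV_rintegrable (M := M)) => // t.
by apply: le_trans (fM t); rewrite ler_wpM2l ?normr_Im_le// ltW// oneDsqr_gt0.
Qed.

Lemma tameM (B : R) f g : tame f -> cmeasurable g -> (forall t, normc (g t) <= B) ->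
  tame (fun t => g t * f t).
Proof.
move=> [mf [M fM]] mg gB; split; first exact: cmeasurableM.
exists (B * M) => t; rewrite Normc.normcM mulrCA.
have B0 : 0 <= B by exact: le_trans (normc_ge0 _) (gB 0).
apply: (le_trans (ler_wpM2r _ (gB t))).
  by rewrite mulr_ge0 ?normc_ge0// ltW// oneDsqr_gt0.
exact: ler_wpM2l.
Qed.

Lemma tame_cis k f : tame f -> tame (fun t => cis (k * t) * f t).
Proof.
move=> tf; apply: (tameM (B := 1)) => //.
  exact/ccontinuous_measurable/ccontinuous_cis.
by move=> t; rewrite normc_cis.
Qed.

Lemma tameZ z f : tame f -> tame (fun t => z * f t).
Proof. move=> tf; exact: (tameM (B := normc z) tf (cmeasurable_cst _ z)). Qed.

Lemma tameD f g : tame f -> tame g -> tame (fun t => f t + g t).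
Proof.
move=> [mf [M fM]] [mg [N gN]]; split; first exact: cmeasurableD.
exists (M + N) => t; apply: le_trans (lerD (fM t) (gN t)).
by rewrite -mulrDr ler_wpM2l ?le_normcD// ltW// oneDsqr_gt0.
Qed.

Lemma eq_cintegral f g : f =1 g -> cintegral f = cintegral g.
Proof. by move=> /funext ->. Qed.

Lemma cintegralD f g : cintegrable f -> cintegrable g ->
  cintegral (fun t => f t + g t) = cintegral f + cintegral g.
Proof.
move=> [f1 f2] [g1 g2]; rewrite /cintegral; apply: complex_ext => /=.
  by rewrite -RintegralD//; apply: eq_Rintegral => t _; rewrite complex_ReD.
by rewrite -RintegralD//; apply: eq_Rintegral => t _; rewrite complex_ImD.
Qed.

Lemma cintegralZ z f : cintegrable f -> cintegral (fun t => z * f t) = z * cintegral f.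
Proof.
move=> [f1 f2]; rewrite /cintegral; apply: complex_ext.
  rewrite complex_ReM /= -!RintegralZl// -RintegralB//.
  - by apply: eq_Rintegral => t _; rewrite complex_ReM.
  - exact: (integrableZl measurableT (Re z) f1).
  - exact: (integrableZl measurableT (Im z) f2).
rewrite complex_ImM /= -!RintegralZl// -RintegralD//.
- by apply: eq_Rintegral => t _; rewrite complex_ImM.
- exact: (integrableZl measurableT (Re z) f2).
- exact: (integrableZl measurableT (Im z) f1).
Qed.

(** The factor 2 comes from bounding the real and imaginary parts separately by the same weighted
    integral. *)
Lemma normc_cintegral_le f M : cmeasurable f -> decays f M ->
  normc (cintegral f) <= 2 * M * \int[mu]_t (1 + t ^+ 2)^-1.
Proof.
move=> mf fM; have [f1 f2] : cintegrable f by apply: tame_integrable; split; [|exists M].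
have iw := integrable_oneDsqrV R.
have iMw := integrableZl measurableT M iw.
have le (g : R -> R) : rintegrable g -> (forall t, `|g t| <= normc (f t)) ->
    `|\int[mu]_t g t| <= M * \int[mu]_t (1 + t ^+ 2)^-1.
  move=> ig gf; apply: (le_trans (le_normr_Rintegral measurableT ig)).
  rewrite -RintegralZl//; apply: le_Rintegral => //.
    exact: integrable_norm.
  move=> t _; rewrite ler_pdivlMr ?oneDsqr_gt0// mulrC.
  by apply: le_trans (fM t); rewrite ler_wpM2l// ltW// oneDsqr_gt0.
apply: (le_trans (normc_le_ReIm _)) => /=.
rewrite -mulrA mulr_natl mulr2n; apply: lerD.
  by apply: le => // t; exact: normr_Re_le.
by apply: le => // t; exact: normr_Im_le.
Qed.

Lemma cvgy_oneDsqr_decay (g : R -> R) (M : R) :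
  (forall t, (1 + t ^+ 2) * `|g t| <= M) -> g x @[x --> +oo] --> 0.
Proof.
move=> gM; have M0 : 0 <= M by apply: le_trans (gM 0); rewrite mulr_ge0// addr_ge0// sqr_ge0.
apply/cvgr0Pnorm_le => e e0.
(* Beyond this threshold [M <= (x - 1) * e], and x - 1 <= 1 + x^2. *)
apply: filterS (nbhs_pinfty_ge (num_real (M / e + 1))) => x xM.
have x1 : 1 <= x by apply: le_trans xM; rewrite lerDr divr_ge0// ltW.
have gx := gM x.
rewrite -(ler_pM2l (oneDsqr_gt0 x)); apply: (le_trans gx).
move: xM; rewrite -lerBrDr ler_pdivrMr// => /le_trans; apply.
rewrite ler_pM2r// expr2; nra.
Qed.

(** The decay of [f] kills the boundary terms at both ends. This is what integration by parts in
    [FT_deriv] uses. *)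
Lemma cintegral_deriv f g : tame f -> tame g -> ccontinuous g -> is_cderiv f g ->
  cintegral g = 0.
Proof.
move=> [_ [M fM]] tg [c1 c2] fg; have [g1 g2] := tame_integrable tg.
have s0 t : 0 <= 1 + t ^+ 2 by exact/ltW/oneDsqr_gt0.
apply: complex_ext => /=.
- have d t : is_derive t (1 : R) (fun t => Re (f t)) (Re (g t)) by have [] := fg t.
  rewrite (@integralT_FTC _ _ (fun t => Re (f t)) 0 0 c1 g1 d) ?subr0//.
  + apply: (@cvgy_oneDsqr_decay _ M) => t.
    by apply: le_trans (fM t); rewrite ler_wpM2l// normr_Re_le.
  + apply: (@cvgy_oneDsqr_decay (fun t => Re (f (- t))) M) => t.
    by rewrite -sqrrN; apply: le_trans (fM (- t)); rewrite ler_wpM2l// normr_Re_le.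
- have d t : is_derive t (1 : R) (fun t => Im (f t)) (Im (g t)) by have [] := fg t.
  rewrite (@integralT_FTC _ _ (fun t => Im (f t)) 0 0 c2 g2 d) ?subr0//.
  + apply: (@cvgy_oneDsqr_decay _ M) => t.
    by apply: le_trans (fM t); rewrite ler_wpM2l// normr_Im_le.
  + apply: (@cvgy_oneDsqr_decay (fun t => Im (f (- t))) M) => t.
    by rewrite -sqrrN; apply: le_trans (fM (- t)); rewrite ler_wpM2l// normr_Im_le.
Qed.

Lemma is_cderiv_under_integral (K dK : R -> R -> R[i]) (M : R) :
  (forall x, cintegrable (K x)) ->
  (forall y, is_cderiv (K ^~ y) (dK ^~ y)) ->
  (forall x, decays (dK x) M) ->
  is_cderiv (fun x => cintegral (K x)) (fun x => cintegral (dK x)).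
Proof.
move=> iK dKE dKM x; split.
- apply: (@is_derive_under_integral _ (fun x y => Re (K x y)) (fun x y => Re (dK x y)) M).
  + by move=> x1; have [] := iK x1.
  + by move=> x1 y; have [] := dKE y x1.
  + move=> x1 y; apply: le_trans (dKM x1 y).
    by rewrite ler_wpM2l ?normr_Re_le// ltW// oneDsqr_gt0.
- apply: (@is_derive_under_integral _ (fun x y => Im (K x y)) (fun x y => Im (dK x y)) M).
  + by move=> x1; have [] := iK x1.
  + by move=> x1 y; have [] := dKE y x1.
  + move=> x1 y; apply: le_trans (dKM x1 y).
    by rewrite ler_wpM2l ?normr_Im_le// ltW// oneDsqr_gt0.
Qed.

Lemma cintegral_Fubini (K : R * R -> R[i]) (M : R) : cmeasurable K ->
  (forall x y, (1 + x ^+ 2) * (1 + y ^+ 2) * normc (K (x, y)) <= M) ->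
  cintegral (fun x => cintegral (fun y => K (x, y))) =
  cintegral (fun y => cintegral (fun x => K (x, y))).
Proof.
move=> [m1 m2] KM; apply: complex_ext => /=.
- apply: (@Rintegral_Fubini R (fun p => Re (K p)) M m1) => x y.
  apply: le_trans (KM x y); rewrite ler_wpM2l ?normr_Re_le//.
  by rewrite mulr_ge0// ltW// oneDsqr_gt0.
- apply: (@Rintegral_Fubini R (fun p => Im (K p)) M m2) => x y.
  apply: le_trans (KM x y); rewrite ler_wpM2l ?normr_Im_le//.
  by rewrite mulr_ge0// ltW// oneDsqr_gt0.
Qed.

Lemma cintegral_subr f k : ccontinuous f -> cintegral f = cintegral (fun x => f (x - k)).
Proof.
move=> [c1 c2]; apply: complex_ext => /=; first exact: (@Rintegral_subr _ (fun x => Re (f x))).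
exact: (@Rintegral_subr _ (fun x => Im (f x))).
Qed.

Lemma cintegral_oppr f : ccontinuous f -> cintegral f = cintegral (fun x => f (- x)).
Proof.
move=> [c1 c2]; apply: complex_ext => /=; first exact: (@Rintegral_oppr _ (fun x => Re (f x))).
exact: (@Rintegral_oppr _ (fun x => Im (f x))).
Qed.

Lemma cintegral_real (f : R -> R) : cintegral (fun t => (f t)%:C) = (\int[mu]_t f t)%:C.
Proof.
apply: complex_ext => //=.
by rewrite Rintegral_cst//= mul0r.
Qed.

End ComplexCalculus.

(** * Fourier transform and convolution *)

Section FourierTransform.
Variable R : realType.
Implicit Types (f g h : R -> R[i]) (t x y k xi : R) (z w : R[i]).
Local Notation normc := Normc.normc.

(* [fourier] is the case k = tau, [fourier_inv] the case k = - tau. *)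
Definition FT k f xi := cintegral (fun x => cis (k * x * xi) * f x).

Lemma fourier_inv_FT f : fourier_inv f = FT (- tau R) f.
Proof.
by apply/funext => xi; apply: eq_cintegral => x; rewrite !mulNr.
Qed.

Lemma tame_FT_integrand k xi f : tame f -> tame (fun x => cis (k * x * xi) * f x).
Proof.
move=> tf; under eq_fun do rewrite mulrAC.
exact: tame_cis.
Qed.

Lemma FTD k f g : tame f -> tame g ->
  FT k (fun t => f t + g t) = (fun xi => FT k f xi + FT k g xi).
Proof.
move=> tf tg; apply/funext => xi; rewrite /FT -cintegralD; first last.
- exact/tame_integrable/tame_FT_integrand.
- exact/tame_integrable/tame_FT_integrand.
- by apply: eq_cintegral => x; rewrite mulrDr.
Qed.

Lemma FTZ k z f : tame f -> FT k (fun t => z * f t) = (fun xi => z * FT k f xi).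
Proof.
move=> tf; apply/funext => xi; rewrite /FT -cintegralZ; last first.
  exact/tame_integrable/tame_FT_integrand.
by apply: eq_cintegral => x; rewrite mulrCA.
Qed.

Lemma FT_bounded k f : tame f -> exists M, forall xi, normc (FT k f xi) <= M.
Proof.
move=> [mf [M fM]]; eexists => xi.
apply: (@normc_cintegral_le _ _ M).
  apply: cmeasurableM => //; apply: cmeasurable_cis.
  by apply: measurable_funM => //; exact: measurable_funM.
by move=> t; rewrite Normc.normcM normc_cis mul1r; exact: fM.
Qed.

(** Integration by parts: the derivative of cis(k xi x) f(x) has integral 0, and its two terms give
    the two sides. *)
Lemma FT_deriv k f g : tame f -> tame g -> ccontinuous g -> is_cderiv f g ->
  FT k g = (fun xi => - (0 +i* (k * xi)) * FT k f xi).
Proof.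
move=> tf tg cg fg; apply/funext => xi.
have dc := @is_cderiv_cis _ (k * xi).
have df := is_cderivM dc fg.
have tcf : tame (fun x => cis (k * xi * x) * f x) by exact: tame_cis.
have tcg : tame (fun x => cis (k * xi * x) * g x) by exact: tame_cis.
have cf := is_cderiv_continuous fg.
have := cintegral_deriv tcf _ _ df.
have tz := tameZ (0 +i* (k * xi)) tcf.
have E : (fun t => (0 +i* (k * xi)) * cis (k * xi * t) * f t + cis (k * xi * t) * g t) =
    (fun t => (0 +i* (k * xi)) * (cis (k * xi * t) * f t) + cis (k * xi * t) * g t).
  by apply/funext => t; rewrite mulrA.
rewrite E => /(_ (tameD tz tcg)) H.
have {}H : cintegral (fun t =>
    (0 +i* (k * xi)) * (cis (k * xi * t) * f t) + cis (k * xi * t) * g t) = 0.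
  apply: H; rewrite -E.
  have cc := is_cderiv_continuous dc.
  have ci := is_cderiv_continuous (is_cderiv_cst (0 +i* (k * xi))).
  have [a1 a2] := ccontinuousM (ccontinuousM ci cc) cf.
  have [b1 b2] := ccontinuousM cc cg.
  split => t.
    by under eq_fun do rewrite complex_ReD; apply: cvgD; [exact: a1|exact: b1].
  by under eq_fun do rewrite complex_ImD; apply: cvgD; [exact: a2|exact: b2].
move: H; rewrite cintegralD; [|exact: tame_integrable..].
rewrite cintegralZ; last exact: tame_integrable.
have FE h : cintegral (fun t => cis (k * xi * t) * h t) = FT k h xi.
  by apply: eq_cintegral => t; rewrite mulrAC.
rewrite !FE addrC => /eqP; rewrite addr_eq0 => /eqP ->.
by rewrite mulNr.
Qed.

(** Differentiation under the integral in the frequency. As [cis] has modulus 1, the decay bound of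
    k t f(t) serves for every [xi]. *)
Lemma FT_mulX k f : tame f -> tame (fun t => t%:C * f t) ->
  is_cderiv (FT k f) (FT k (fun t => (0 +i* k) * (t%:C * f t))).
Proof.
move=> tf txf; have := tameZ (0 +i* k) txf => -[_ [M HM]].
apply: (is_cderiv_under_integral (M := M)
  (dK := fun xi x => cis (k * x * xi) * ((0 +i* k) * (x%:C * f x)))).
- by move=> xi; exact/tame_integrable/tame_FT_integrand.
- move=> x; have := is_cderivM (@is_cderiv_cis _ (k * x)) (is_cderiv_cst (f x)).
  move/is_cderiv_ext; apply => xi.
  rewrite mulr0 addr0 (_ : 0 +i* (k * x) = (0 +i* k) * x%:C); first by ring.
  by apply: complex_ext; rewrite /= ?mulr0 ?mul0r ?subr0 ?add0r ?addr0.
- by move=> xi x; rewrite Normc.normcM normc_cis mul1r; exact: HM.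
Qed.

Lemma FT_oppr k f xi : ccontinuous f -> FT k (fun x => f (- x)) xi = FT (- k) f xi.
Proof.
move=> cf; rewrite /FT [RHS]cintegral_oppr.
  by apply: eq_cintegral => x; rewrite mulrNN.
apply: ccontinuousM => //.
by under eq_fun do rewrite mulrAC; exact: ccontinuous_cis.
Qed.

(** Integrals are exchanged in f(y) cis(- k xi (x - y)) b(xi). The phase splits as cis(- k xi x)
    cis(k y xi), which leaves [FT k f xi] inside; the modulus |f(y)| |b(xi)| is already a product,
    so the two decay bounds multiply. *)
Lemma conv_FT k f b : tame f -> tame b ->
  conv f (FT (- k) b) = FT (- k) (fun xi => FT k f xi * b xi).
Proof.
move=> [mf [M fM]] [mb [N bN]]; apply/funext => x.
have tf : tame f by split; [|exists M].
have tb : tame b by split; [|exists N].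
pose K (p : R * R) := f p.1 * (cis (- k * p.2 * (x - p.1)) * b p.2).
transitivity (cintegral (fun y => cintegral (fun xi => K (y, xi)))).
  apply: eq_cintegral => y; rewrite -cintegralZ//.
  exact/tame_integrable/tame_FT_integrand.
rewrite (@cintegral_Fubini _ _ (M * N)).
- apply: eq_cintegral => xi.
  transitivity ((cis (- k * xi * x) * b xi) * FT k f xi); last by ring.
  rewrite -cintegralZ; last exact/tame_integrable/tame_FT_integrand.
  apply: eq_cintegral => y; rewrite /K /=.
  rewrite mulrBr (_ : - k * xi * x - - k * xi * y = - k * xi * x + k * y * xi); last by ring.
  by rewrite cisD; ring.
- apply: cmeasurableM; first by apply: cmeasurable_comp => //; exact: measurable_fst.
  apply: cmeasurableM; last by apply: cmeasurable_comp => //; exact: measurable_snd.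
  apply: cmeasurable_cis; apply: measurable_funM; first exact: measurable_funM.
  exact: measurable_funB.
- move=> y xi; rewrite /K !Normc.normcM normc_cis mul1r mulrACA.
  by apply: ler_pM => //; rewrite mulr_ge0 ?normc_ge0// ltW// oneDsqr_gt0.
Qed.

(** A form of Peetre's inequality. With d = x - y, the hint (d - y)^2 >= 0 gives (d + y)^2 <= 2 (d^2
    + y^2), and (d y)^2 >= 0 covers the remaining term of the product. *)
Lemma oneDsqr_le_sub (x y : R) : 1 + x ^+ 2 <= 2 * (1 + y ^+ 2) * (1 + (x - y) ^+ 2).
Proof.
have := sqr_ge0 (x - y - y); have := sqr_ge0 (y * (x - y)).
have := sqr_ge0 y; have := sqr_ge0 (x - y).
rewrite !expr2; set d := x - y; rewrite (_ : x = d + y); last by rewrite /d; ring.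
nra.
Qed.

(* The extra factor 1 + t^2 yields a kernel dominated by a product of integrable
   functions, by [oneDsqr_le_sub]. *)
Lemma FT_conv k f g : tame (fun t => (1 + t ^+ 2)%:C * f t) -> cmeasurable f ->
  tame g -> ccontinuous g ->
  FT k (conv f g) = (fun xi => FT k f xi * FT k g xi).
Proof.
move=> [_ [M fM]] mf [mg [N gN]] cg; apply/funext => xi.
have M2 t : (1 + t ^+ 2) ^+ 2 * normc (f t) <= M.
  have := fM t; rewrite Normc.normcM normc_real ger0_norm; last exact/ltW/oneDsqr_gt0.
  by rewrite mulrA expr2.
have tf : tame f.
  split => //; exists M => t; apply: le_trans (M2 t).
  rewrite ler_wpM2r ?normc_ge0// expr2 ler_pMl ?oneDsqr_gt0//.
  by rewrite lerDl sqr_ge0.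
have tg : tame g by split; [|exists N].
have cgk : ccontinuous (fun x => cis (k * x * xi) * g x).
  apply: ccontinuousM => //.
  by under eq_fun do rewrite mulrAC; exact: ccontinuous_cis.
have c0 y : 0 <= 2 * (1 + y ^+ 2) by rewrite mulr_ge0// ltW// oneDsqr_gt0.
have tgr y : tame (fun x => g (y - x)).
  split.
    by apply: cmeasurable_comp => //; exact: measurable_funB.
  exists (2 * (1 + y ^+ 2) * N) => x.
  apply: (@le_trans _ _ (2 * (1 + y ^+ 2) * (1 + (x - y) ^+ 2) * normc (g (y - x)))).
    by rewrite ler_wpM2r ?normc_ge0// oneDsqr_le_sub.
  rewrite -mulrA; apply: ler_wpM2l => //.
  by rewrite -[x - y]opprB sqrrN; exact: gN.
have tgl y : tame (fun x => g (x - y)).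
  split.
    by apply: cmeasurable_comp => //; exact: measurable_funB.
  exists (2 * (1 + y ^+ 2) * N) => x.
  apply: (@le_trans _ _ (2 * (1 + y ^+ 2) * (1 + (x - y) ^+ 2) * normc (g (x - y)))).
    by rewrite ler_wpM2r ?normc_ge0// oneDsqr_le_sub.
  by rewrite -mulrA; apply: ler_wpM2l => //; exact: gN.
pose K (p : R * R) := cis (k * p.1 * xi) * (f p.2 * g (p.1 - p.2)).
transitivity (cintegral (fun x => cintegral (fun y => K (x, y)))).
  apply: eq_cintegral => x; rewrite -cintegralZ//.
  have [B gB] : exists B, forall y, normc (g (x - y)) <= B.
    exists N => y; apply: le_trans (gN (x - y)).
    by rewrite ler_peMl ?normc_ge0// lerDl sqr_ge0.
  under eq_fun do rewrite mulrC.
  apply: tame_integrable; apply: (tameM (B := B)) => //.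
  by have [] := tgr x.
(* The 2 is that of [oneDsqr_le_sub]. One weight of [f] pays for turning the weight in x into one in
   x - y, the other for the integral over y. *)
rewrite (@cintegral_Fubini _ _ (2 * (M * N))).
- transitivity (cintegral (fun y => FT k g xi * (cis (k * y * xi) * f y))).
    apply: eq_cintegral => y; rewrite mulrC /FT.
    rewrite (cintegral_subr y cgk) -cintegralZ.
      apply: eq_cintegral => x; rewrite /K /=.
      rewrite (_ : k * x * xi = k * y * xi + k * (x - y) * xi); last by ring.
      by rewrite cisD; ring.
    apply: tame_integrable; apply: (tameM (B := 1)) => //.
      apply: cmeasurable_cis; apply: measurable_funM => //.
      by apply: measurable_funM => //; exact: measurable_funB.
    by move=> x; rewrite normc_cis.
  rewrite cintegralZ; first by rewrite [LHS]mulrC.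
  exact/tame_integrable/tame_FT_integrand.
- apply: cmeasurableM.
    apply: cmeasurable_cis; apply: measurable_funM => //; exact: measurable_funM.
  apply: cmeasurableM; first by apply: cmeasurable_comp => //; exact: measurable_snd.
  apply: cmeasurable_comp => //; exact: measurable_funB.
- move=> x y; rewrite /K !Normc.normcM normc_cis mul1r /=.
  apply: (@le_trans _ _ (2 * (((1 + y ^+ 2) ^+ 2 * normc (f y)) *
      ((1 + (x - y) ^+ 2) * normc (g (x - y)))))).
    rewrite [leRHS](_ : _ = (2 * (1 + y ^+ 2) * (1 + (x - y) ^+ 2)) *
      (1 + y ^+ 2) * (normc (f y) * normc (g (x - y)))); last by ring.
    rewrite ler_wpM2r ?mulr_ge0 ?normc_ge0// ler_wpM2r ?oneDsqr_le_sub//.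
    exact/ltW/oneDsqr_gt0.
  rewrite ler_pM2l// ler_pM// ?mulr_ge0 ?normc_ge0 ?exprn_ge0// ltW//; exact: oneDsqr_gt0.
Qed.

Lemma fourierE f : fourier f = FT (tau R) f. Proof. by []. Qed.

End FourierTransform.

(** * Weyl-stable spaces of bounded functions *)

Section RapidModules.
Variable R : realType.
Implicit Types (A : set (R -> R[i])) (f g h : R -> R[i]) (t x y k xi : R) (z w : R[i]).
Local Notation normc := Normc.normc.

(* A space of bounded functions that is stable under x and d/dx consists of
   Schwartz functions; no decay has to be checked by hand. *)
Record rapid_module A : Prop := {
  rapid0 : A (fun=> 0);
  rapidD : forall f g, A f -> A g -> A (fun t => f t + g t);
  rapidZ : forall z f, A f -> A (fun t => z * f t);
  rapidX : forall f, A f -> A (fun t => t%:C * f t);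
  rapid_deriv : forall f, A f -> exists2 g, is_cderiv f g & A g;
  rapid_bounded : forall f, A f -> exists M, forall t, normc (f t) <= M }.

Section Theory.
Variables (A : set (R -> R[i])) (rA : rapid_module A).

Lemma rapid_is_cderiv f : A f -> is_cderiv f (cderiv f).
Proof. by move=> /(rapid_deriv rA)[g fg _]; rewrite (is_cderiv_cderiv fg). Qed.

Lemma rapid_cderiv f : A f -> A (cderiv f).
Proof. by move=> /(rapid_deriv rA)[g fg Ag]; rewrite (is_cderiv_cderiv fg). Qed.

Lemma rapid_ccontinuous f : A f -> ccontinuous f.
Proof. by move=> /rapid_is_cderiv; exact: is_cderiv_continuous. Qed.

Lemma rapid_Xn n f : A f -> A (fun t => (t ^+ n)%:C * f t).
Proof.
move=> Af; elim: n => [|n IH].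
  by under eq_fun do rewrite expr0 mul1r.
have := rapidX rA IH; congr A; apply/funext => t.
by rewrite mulrA exprS rmorphM.
Qed.

Lemma rapid_tame f : A f -> tame f.
Proof.
move=> Af; split; first exact/ccontinuous_measurable/rapid_ccontinuous.
have [M fM] := rapid_bounded rA Af.
have [N fN] := rapid_bounded rA (rapid_Xn 2 Af).
exists (M + N) => t; rewrite mulrDl mul1r lerD//.
apply: le_trans (fN t).
by rewrite Normc.normcM normc_real ger0_norm// sqr_ge0.
Qed.

Lemma rapid_schwartz : A `<=` @schwartz R.
Proof.
move=> f Af.
have An n : A (cderivn n f).
  by elim: n => //= n IH; exact: rapid_cderiv.
split=> [n t|m n]; first exact: is_cderiv_cderivable (rapid_is_cderiv (An n)).
have [M fM] := rapid_bounded rA (rapid_Xn m (An n)).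
exists M => t; apply: le_trans (fM t).
by rewrite Normc.normcM normc_real normrX.
Qed.

Lemma rapid_wact T f : A f -> A (wact T f).
Proof.
elim: T f => [||c|T1 IH1 T2 IH2|T1 IH1 T2 IH2] f Af /=.
- exact: rapidX.
- exact: rapid_cderiv.
- exact: rapidZ.
- by apply: rapidD => //; [exact: IH1|exact: IH2].
- exact/IH1/IH2.
Qed.

Lemma rapid_weyl_submodule : weyl_submodule A.
Proof.
split; [exact: rapid_schwartz|exact: rapid0|exact: rapidD|exact: rapid_wact].
Qed.

Lemma cderiv_FT k f : A f ->
  cderiv (FT k f) = (fun xi => (0 +i* k) * FT k (fun t => t%:C * f t) xi).
Proof.
move=> Af; have tx := rapid_tame (rapidX rA Af).
rewrite (is_cderiv_cderiv (FT_mulX k (rapid_tame Af) tx)).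
by rewrite FTZ.
Qed.

Lemma FT_cderiv k f : A f ->
  FT k (cderiv f) = (fun xi => - (0 +i* k) * (xi%:C * FT k f xi)).
Proof.
move=> Af; have Af' := rapid_cderiv Af.
rewrite (FT_deriv k (rapid_tame Af) (rapid_tame Af') (rapid_ccontinuous Af')).
  apply/funext => xi; rewrite mulrA; congr (_ * _).
  rewrite mulNr; congr (- _).
  by apply: complex_ext; rewrite /= ?mulr0 ?mul0r ?subr0 ?addr0 ?add0r.
exact: rapid_is_cderiv.
Qed.

(** The transform exchanges the generators: multiplication by x on the image comes from the
    derivative of [f], the derivative from multiplying [f] by x, and boundedness from the
    integrability of [f]. Recovering x divides by i k. *)
Lemma rapid_FT k : k != 0 -> rapid_module (FT k @` A).
Proof.
move=> k0; have ik0 : (0 +i* k) != 0 :> R[i] by rewrite eq_complex /= negb_and k0 orbT.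
split.
- exists (fun=> 0); first exact: rapid0.
  have := FTZ k 0 (rapid_tame (rapid0 rA)).
  under eq_fun do rewrite mul0r.
  by move=> ->; apply/funext => xi; rewrite mul0r.
- move=> _ _ [f Af <-] [g Ag <-]; exists (fun t => f t + g t); first exact: rapidD.
  by rewrite FTD//; exact: rapid_tame.
- move=> z _ [f Af <-]; exists (fun t => z * f t); first exact: rapidZ.
  by rewrite FTZ//; exact: rapid_tame.
- move=> _ [f Af <-]; exists (fun t => (- (0 +i* k))^-1 * cderiv f t).
    exact/(rapidZ rA)/rapid_cderiv.
  rewrite FTZ; last exact/rapid_tame/rapid_cderiv.
  by rewrite FT_cderiv//; apply/funext => xi; rewrite mulKf// oppr_eq0.
- move=> _ [f Af <-]; exists (FT k (fun t => (0 +i* k) * (t%:C * f t))).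
    by apply: FT_mulX; apply: rapid_tame => //; exact: rapidX.
  by eexists; [|reflexivity]; exact/(rapidZ rA)/(rapidX rA).
- by move=> _ [f Af <-]; apply: FT_bounded; exact: rapid_tame.
Qed.

Lemma fourier_wact T f : A f ->
  fourier (wact T f) = wact (wfourier T) (fourier f).
Proof.
have tau0 : tau R != 0 by rewrite mulf_neq0 ?pnatr_eq0// gt_eqF// pi_gt0.
have it0 : itau R != 0 by rewrite eq_complex /= negb_and tau0 orbT.
elim: T f => [||c|T1 IH1 T2 IH2|T1 IH1 T2 IH2] f Af.
- rewrite /= !fourierE cderiv_FT//; apply/funext => xi /=.
  by rewrite mulKf.
- by rewrite /= !fourierE FT_cderiv.
- by rewrite /= !fourierE (FTZ _ c (rapid_tame Af)).
- rewrite /= -IH1// -IH2// !fourierE.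
  by rewrite (FTD _ (rapid_tame (rapid_wact T1 Af)) (rapid_tame (rapid_wact T2 Af))).
- by rewrite /= IH1 ?IH2//; exact: rapid_wact.
Qed.

End Theory.
End RapidModules.

(** * Hyperbolic functions *)

Section Hyperbolic.
Variable R : realType.
Implicit Types (t x y : R).
Let mu := @lebesgue_measure R.
Local Notation sinh := (@sinh R).
Local Notation cosh := (@cosh R).
Local Notation s := (@s_fun R).
Local Notation h := (@h_fun R).
Local Notation xc := (@xc_fun R).
Local Notation pi := (@pi R).

Lemma cosh_gt0 t : 0 < cosh t.
Proof. by rewrite /Defs.cosh divr_gt0// addr_gt0// expR_gt0. Qed.

Lemma cosh_neq0 t : cosh t != 0.
Proof. by rewrite gt_eqF// cosh_gt0. Qed.

Lemma coshN t : cosh (- t) = cosh t.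
Proof. by rewrite /Defs.cosh opprK addrC. Qed.

Lemma sinhN t : sinh (- t) = - sinh t.
Proof. by rewrite /Defs.sinh opprK -mulNr opprB. Qed.

Lemma sinh0 : sinh 0 = 0.
Proof. by rewrite /Defs.sinh oppr0 subrr mul0r. Qed.

Lemma cosh0 : cosh 0 = 1.
Proof. by rewrite /Defs.cosh oppr0 expR0; field. Qed.

Lemma sinhD x y : sinh (x + y) = sinh x * cosh y + cosh x * sinh y.
Proof. by rewrite /Defs.sinh /Defs.cosh opprD !expRD; field. Qed.

Lemma coshD x y : cosh (x + y) = cosh x * cosh y + sinh x * sinh y.
Proof. by rewrite /Defs.sinh /Defs.cosh opprD !expRD; field. Qed.

Lemma cosh2Bsinh2 t : cosh t ^+ 2 - sinh t ^+ 2 = 1.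
Proof.
rewrite -cosh0 -(subrr t) coshD sinhN coshN; ring.
Qed.

Lemma is_derive_sinh t : is_derive t (1 : R) sinh (cosh t).
Proof.
rewrite /Defs.sinh /Defs.cosh; apply: is_derive_eq.
by rewrite /GRing.scale/=; field.
Qed.

Lemma is_derive_cosh t : is_derive t (1 : R) cosh (sinh t).
Proof.
rewrite /Defs.sinh /Defs.cosh; apply: is_derive_eq.
by rewrite /GRing.scale/=; field.
Qed.

Lemma is_derive_pi t : is_derive t (1 : R) (fun u => pi * u) pi.
Proof. by apply: is_derive_eq; rewrite /GRing.scale/=; ring. Qed.

Lemma is_derive_sinh_pi t : is_derive t (1 : R) (fun u => sinh (pi * u)) (pi * cosh (pi * t)).
Proof.
have d2 := is_derive_pi t; have d1 := is_derive_sinh (pi * t).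
by rewrite mulrC; exact: (is_derive1_comp d1 d2).
Qed.

Lemma is_derive_cosh_pi t : is_derive t (1 : R) (fun u => cosh (pi * u)) (pi * sinh (pi * t)).
Proof.
have d2 := is_derive_pi t; have d1 := is_derive_cosh (pi * t).
by rewrite mulrC; exact: (is_derive1_comp d1 d2).
Qed.

Lemma is_derive_s_fun t : is_derive t (1 : R) s (- pi * (s t * h t)).
Proof.
have d := is_derive_cosh_pi t.
have d' := is_deriveV (f := fun u => cosh (pi * u)) (cosh_neq0 (pi * t)) d.
apply: is_derive_eq d' _.
by rewrite /GRing.scale/= /s_fun /h_fun; field; exact: cosh_neq0.
Qed.

Lemma is_derive_h_fun t : is_derive t (1 : R) h (pi * s t ^+ 2).
Proof.
have d := is_derive_cosh_pi t; have d1 := is_derive_sinh_pi t.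
have d' := is_deriveV (f := fun u => cosh (pi * u)) (cosh_neq0 (pi * t)) d.
apply: is_derive_eq (is_deriveM d1 d') _.
rewrite /GRing.scale/= /s_fun.
have := cosh2Bsinh2 (pi * t); set C := cosh _; set S := sinh _ => CS.
have C0 : C != 0 by exact: cosh_neq0.
by rewrite -[pi in RHS]mulr1 -CS; field.
Qed.

Lemma h_fun_sqr t : h t ^+ 2 = 1 - s t ^+ 2.
Proof.
have := cosh2Bsinh2 (pi * t); rewrite /h_fun /s_fun.
have := cosh_neq0 (pi * t); set C := cosh _; set S := sinh _ => C0 CS.
apply: (mulIf (expf_neq0 2 C0)).
rewrite mulrBl -!exprMn mulVf// divfK// mul1r expr1n; lra.
Qed.

Lemma s_fun_gt0 t : 0 < s t.
Proof. by rewrite invr_gt0 cosh_gt0. Qed.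

Lemma s_fun_le1 t : s t <= 1.
Proof.
have := h_fun_sqr t; have := sqr_ge0 (h t); have := s_fun_gt0 t; nra.
Qed.

Lemma normr_h_fun_le1 t : `|h t| <= 1.
Proof.
rewrite -[leRHS]ger0_norm// -ler_sqr ?nnegrE// !real_normK ?num_real//.
by rewrite h_fun_sqr expr1n lerBlDr lerDl sqr_ge0.
Qed.

Lemma s_funN t : s (- t) = s t.
Proof. by rewrite /s_fun mulrN coshN. Qed.

Lemma h_funN t : h (- t) = - h t.
Proof. by rewrite /h_fun mulrN coshN sinhN mulNr. Qed.

Lemma xc_funN t : xc (- t) = xc t.
Proof. by rewrite /xc_fun oppr_eq0; case: eqP => // _; rewrite mulrN sinhN invrN mulrNN. Qed.

Lemma s_fun0 : s 0 = 1.
Proof. by rewrite /s_fun mulr0 cosh0 invr1. Qed.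

Lemma h_fun0 : h 0 = 0.
Proof. by rewrite /h_fun mulr0 sinh0 mul0r. Qed.

Lemma exprn_le_fact_expR n t : 0 <= t -> t ^+ n <= n`!%:R * expR t.
Proof.
move=> t0; case: n => [|n].
  by rewrite fact0 expr0 mul1r -expR0 ler_expR.
rewrite mulrC -ler_pdivrMr ?ltr0n ?fact_gt0//.
by apply: le_trans (expR_ge1Dxn n t0); rewrite lerDr.
Qed.

(** Of the two exponentials in cosh(pi t) only the growing one is kept, and pi >= 1 removes pi from
    the exponent. *)
Lemma s_fun_le_expR t : s t <= 2 * expR (- `|t|).
Proof.
rewrite expRN -lef_pV2 ?posrE ?s_fun_gt0 ?mulr_gt0 ?invr_gt0 ?expR_gt0//.
rewrite invfM invrK /s_fun invrK /Defs.cosh mulrC ler_wpM2r//.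
have pi1 : 1 <= pi by apply: le_trans (pi_ge2 R); rewrite ler1n.
have [t0|t0] := leP 0 t.
  by rewrite ger0_norm// ler_wpDr ?expR_ge0// ler_expR ler_peMl.
rewrite ltr0_norm// ler_wpDl ?expR_ge0// ler_expR -mulrN ler_peMl// oppr_ge0 ltW//.
Qed.

Lemma s_fun_decay n : exists M : R, forall t, (1 + `|t|) ^+ n * s t <= M.
Proof.
(* From (1 + |t|)^n <= n! e^(1 + |t|) and s(t) <= 2 e^(- |t|); the exponentials multiply to e. *)
exists (n`!%:R * expR 1 * 2) => t.
have t0 : 0 <= 1 + `|t| by rewrite addr_ge0.
apply: (@le_trans _ _ (n`!%:R * expR (1 + `|t|) * (2 * expR (- `|t|)))).
  apply: ler_pM; rewrite ?exprn_ge0 ?exprn_le_fact_expR ?s_fun_le_expR//.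
  exact/ltW/s_fun_gt0.
rewrite expRD expRN; rewrite le_eqVlt; apply/orP; left; apply/eqP; field.
by rewrite gt_eqF ?expR_gt0.
Qed.

(** After multiplication by e^t this follows from 1 + 2 t <= e^(2 t). *)
Lemma sinh_ge t : 0 <= t -> t * expR (- t) <= sinh t.
Proof.
move=> t0; rewrite /Defs.sinh -(ler_pM2r (expR_gt0 t)) -mulrA -expRD addNr expR0 mulr1.
rewrite -mulrA [_^-1 * _]mulrC mulrA mulrBl -!expRD addNr expR0.
have := expR_ge1Dx (t + t); lra.
Qed.

Lemma sinh_gt0 t : 0 < t -> 0 < sinh t.
Proof.
move=> t0; apply: lt_le_trans (sinh_ge (ltW t0)).
by rewrite mulr_gt0// expR_gt0.
Qed.

Lemma sinh_pi_neq0 t : t != 0 -> sinh (pi * t) != 0.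
Proof.
rewrite neq_lt => /orP[t0|t0].
  by rewrite -[pi * t]opprK sinhN oppr_eq0 gt_eqF// sinh_gt0// -mulrN mulr_gt0 ?pi_gt0// oppr_gt0.
by rewrite gt_eqF// sinh_gt0// mulr_gt0 ?pi_gt0.
Qed.

Lemma xc_fun_gt0 t : 0 < xc t.
Proof.
wlog t0 : t / 0 <= t.
  by move=> H; have [/H//|/ltW t0] := leP 0 t; rewrite -xc_funN H// oppr_ge0.
rewrite /xc_fun; case: eqP => [_|/eqP t1]; first by rewrite invr_gt0 pi_gt0.
have {}t0 : 0 < t by rewrite lt_neqAle eq_sym t1.
by rewrite divr_gt0// sinh_gt0// mulr_gt0 ?pi_gt0.
Qed.

(** For t > 0 let C and S be cosh and sinh of pi t. Clearing denominators leaves t (C - S) <= S;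
    since C - S = e^(- pi t), this is [sinh_ge] at pi t, weakened by pi >= 1. *)
Lemma xc_fun_le t : xc t <= (1 + `|t|) * s t.
Proof.
wlog t0 : t / 0 <= t.
  move=> H; have [/H//|/ltW t0] := leP 0 t.
  by rewrite -xc_funN -normrN -s_funN H// oppr_ge0.
have pi1 : 1 <= pi by apply: le_trans (pi_ge2 R); rewrite ler1n.
rewrite /xc_fun; case: eqP => [->|/eqP t1].
  by rewrite normr0 addr0 mul1r s_fun0 invf_le1// pi_gt0.
have {}t0 : 0 < t by rewrite lt_neqAle eq_sym t1.
have pt0 : 0 < pi * t by rewrite mulr_gt0// pi_gt0.
have := sinh_ge (ltW pt0); have S0 := sinh_gt0 pt0.
have -> : expR (- (pi * t)) = cosh (pi * t) - sinh (pi * t).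
  by rewrite /Defs.cosh /Defs.sinh; field.
have C0 := cosh_gt0 (pi * t); rewrite /s_fun (ger0_norm (ltW t0)).
set C := cosh _ in C0 *; set S := sinh _ in S0 * => H.
have : t * (C - S) <= S.
  apply: le_trans H; rewrite ler_wpM2r//; last by rewrite ler_peMl// ltW.
  rewrite (_ : C - S = expR (- (pi * t))) ?expR_ge0//.
  by rewrite /C /S /Defs.cosh /Defs.sinh; field.
clearbody C S; move=> {}H; have -> : t / S = t * C / (S * C).
  by field; rewrite !gt_eqF.
have -> : (1 + t) / C = (1 + t) * S / (S * C).
  by field; rewrite !gt_eqF.
rewrite ler_pM2r ?invr_gt0 ?mulr_gt0//.
move: H; rewrite mulrBr mulrDl mul1r; lra.
Qed.

Lemma continuous_s_fun : continuous s.
Proof.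
move=> t; apply/differentiable_continuous/derivable1_diffP.
have := is_derive_s_fun t => d; exact: ex_derive.
Qed.

Lemma continuous_xc_fun : continuous xc.
Proof.
move=> t; have [->|t0] := eqVneq t 0.
  (* The Caratheodory slope satisfies sinh(pi z) = g(z) z, so [xc] is 1 / g everywhere: at 0, g is
     pi, the reciprocal of the value built into [xc_fun]. *)
  have /is_derive1_caratheodory [g [gE cg g0]] := is_derive_sinh_pi 0.
  have g0' : g 0 = pi by rewrite g0 mulr0 cosh0 mulr1.
  rewrite (_ : xc = (fun z => (g z)^-1)).
    by apply: continuousV => //; rewrite g0' gt_eqF// pi_gt0.
  apply/funext => z; rewrite /xc_fun; case: eqP => [->|/eqP z0]; first by rewrite g0'.
  have := gE z; rewrite mulr0 sinh0 !subr0 => ->.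
  by rewrite invfM mulrCA mulfV ?mulr1.
pose f u := u * (sinh (pi * u))^-1.
have cS : {for t, continuous (fun u => sinh (pi * u))}.
  apply/differentiable_continuous/derivable1_diffP.
  have := is_derive_sinh_pi t => d; exact: ex_derive.
have cf : {for t, continuous f}.
  apply: cvgM; first exact: cvg_id.
  by apply: cvgV => //; exact: sinh_pi_neq0.
rewrite /continuous_at /xc_fun (negbTE t0).
apply: cvg_trans cf; apply: near_eq_cvg.
have : \forall u \near t, u != 0.
  by apply: (@cvgr_neq0 _ _ _ (nbhs t) _ id t) => //; exact: cvg_id.
apply: filterS => u u0; rewrite (negbTE u0)//.
Qed.

(** The addition formula of sinh over a common denominator. It exhibits s(y) s(x - y) as a
    combination of logarithmic derivatives of cosh. *)
Lemma h_fun_add x y : h y + h (x - y) = sinh (pi * x) * (s y * s (x - y)).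
Proof.
rewrite /h_fun /s_fun.
have -> : sinh (pi * x) = sinh (pi * y + pi * (x - y)) by congr sinh; ring.
rewrite sinhD; have := cosh_neq0 (pi * y); have := cosh_neq0 (pi * (x - y)) => a b.
by field; rewrite a b.
Qed.

(** For y != 0, the addition formula of cosh gives csch(pi y) sech(pi (x - y)) = sech(pi x) (coth(pi
    y) + tanh(pi (x - y))), and coth(pi y) = 2 csch(2 pi y) + tanh(pi y). Multiplying by y leaves
    one term independent of x and one covered by [h_fun_add]. *)
Lemma xc_fun_mul_s_fun x y :
  xc y * s (x - y) = s x * (xc (2 * y) + y * (h y + h (x - y))).
Proof.
have [->|y0] := eqVneq y 0.
  by rewrite mulr0 mul0r addr0 subr0 mulrC.
rewrite /xc_fun mulf_eq0 (negbTE y0) pnatr_eq0/=.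
rewrite /h_fun /s_fun.
have -> : cosh (pi * x) = cosh (pi * y + pi * (x - y)) by congr cosh; ring.
have -> : sinh (pi * (2 * y)) = sinh (pi * y + pi * y) by congr sinh; ring.
have Cx : cosh (pi * y + pi * (x - y)) != 0 by exact: cosh_neq0.
move: Cx; rewrite sinhD coshD.
have := cosh_neq0 (pi * y); have := cosh_neq0 (pi * (x - y)).
have := sinh_pi_neq0 y0; have := cosh2Bsinh2 (pi * y).
set C1 := cosh (pi * y); set S1 := sinh (pi * y).
set C2 := cosh (pi * (x - y)); set S2 := sinh (pi * (x - y)).
move=> CS S10 C20 C10 Cx.
(* The number 1 is inserted as C1^2 - S1^2, so that the final identity holds for free variables and
   [field] proves it. *)
have -> : 2 * y / (S1 * C1 + C1 * S1) = y * (C1 ^+ 2 - S1 ^+ 2) / (S1 * C1).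
  rewrite CS (_ : S1 * C1 + C1 * S1 = 2 * (S1 * C1)); last by ring.
  by field; rewrite S10 C10.
by field; rewrite S10 C10 C20 Cx.
Qed.

End Hyperbolic.

(** * Integrals of sech and of sech against its translates *)

Section HyperbolicIntegrals.
Variable R : realType.
Implicit Types (t x y : R).
Let mu := @lebesgue_measure R.
Local Notation sinh := (@sinh R).
Local Notation cosh := (@cosh R).
Local Notation s := (@s_fun R).
Local Notation h := (@h_fun R).
Local Notation xc := (@xc_fun R).
Local Notation pi := (@pi R).

Lemma oneDsqr_le_normr t : 1 + t ^+ 2 <= (1 + `|t|) ^+ 2.
Proof. by rewrite -(real_normK (num_real t)); have := normr_ge0 t; nra. Qed.

Lemma rintegrable_le_s_fun n (f : R -> R) : continuous f ->
  (forall t, `|f t| <= (1 + `|t|) ^+ n * s t) -> rintegrable f.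
Proof.
move=> cf fs; have [M sM] := s_fun_decay R n.+2.
apply: (@le_oneDsqrV_rintegrable _ _ M); first exact: continuous_measurable_fun.
move=> t; apply: le_trans (sM t).
apply: (@le_trans _ _ ((1 + `|t|) ^+ 2 * ((1 + `|t|) ^+ n * s t))); last first.
  by rewrite mulrA -exprD add2n.
apply: ler_pM => //; first exact/ltW/oneDsqr_gt0.
exact: oneDsqr_le_normr.
Qed.

Lemma cvgy_expR_pi : (fun x => expR (pi * x)) x @[x --> +oo] --> +oo.
Proof.
apply/cvgryPge => A.
apply: filterS (nbhs_pinfty_ge (num_real (A / pi))) => x xA.
apply: le_trans (expR_ge1Dx _); rewrite ler_wpDl//.
by rewrite mulrC -ler_pdivrMr ?pi_gt0.
Qed.

Lemma cvgy_expR_Npi (c : R) : 0 < c -> expR (- (c * x)) @[x --> +oo] --> 0.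
Proof.
move=> c0; apply: (cvg_comp (fun x => c * x) (fun x => expR (- x)) _ (@cvgr_expR R)).
apply/cvgryPge => A.
apply: filterS (nbhs_pinfty_ge (num_real (A / c))) => x xA.
by rewrite mulrC -ler_pdivrMr.
Qed.

Lemma atan_continuous : continuous (@atan R).
Proof. by move=> x; exact: continuous_atan. Qed.

Lemma integral_s_fun : \int[mu]_t s t = 1.
Proof.
have pi0 : pi != 0 by rewrite gt_eqF// pi_gt0.
(* A Gudermannian: the arctangent runs from 0 to pi / 2, and the factor 2 / pi makes the total 1. *)
pose F t := 2 / pi * atan (expR (pi * t)).
have dF t : is_derive t (1 : R) F (s t).
  have d1 : is_derive t (1 : R) (fun u => expR (pi * u)) (expR (pi * t) * pi).
    exact: (is_derive1_comp (is_derive_expR _) (is_derive_pi t)).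
  have d2 := is_derive1_comp (f := @atan R) (is_derive1_atan _) d1.
  apply: is_derive_eq (is_deriveZ (2 / pi) d2) _.
  rewrite /GRing.scale/= /s_fun /Defs.cosh expRN.
  have e0 := expR_gt0 (pi * t); set e := expR _ in e0 *; clearbody e.
  move: pi0; generalize pi => p p0.
  by field; rewrite p0 !gt_eqF ?addr_gt0 ?mulr_gt0.
have ints : rintegrable s.
  apply: (@rintegrable_le_s_fun 0); first exact: continuous_s_fun.
  by move=> t; rewrite expr0 mul1r ger0_norm// ltW// s_fun_gt0.
rewrite (@integralT_FTC _ s F 1 0 (@continuous_s_fun R) ints dF) ?subr0//.
  have E : 2 / pi * (pi / 2) = 1 :> R.
    by move: pi0; generalize pi => p p0; field.
  rewrite -[X in _ --> X]E.
  apply: cvgMr; exact: (cvg_comp _ _ cvgy_expR_pi (@cvgy_atan R)).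
rewrite -[X in _ --> X](mulr0 (2 / pi)) -(@atan0 R).
rewrite /F; apply: cvgMr.
under eq_fun do rewrite mulrN.
exact: (cvg_comp _ _ (cvgy_expR_Npi (pi_gt0 R)) (@atan_continuous 0)).
Qed.

Lemma continuous_s_sub x : continuous (fun y => s (x - y)).
Proof.
move=> y; apply: (@continuous_comp _ _ _ (fun y => x - y) s); last exact: continuous_s_fun.
by apply: cvgB; [exact: cvg_cst|exact: cvg_id].
Qed.

Lemma continuous_s_conv x : continuous (fun y => s y * s (x - y)).
Proof. by move=> y; apply: cvgM; [exact: continuous_s_fun|exact: continuous_s_sub]. Qed.

Lemma rintegrable_s_conv x : rintegrable (fun y => s y * s (x - y)).
Proof.
apply: (@rintegrable_le_s_fun 0); first exact: continuous_s_conv.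
have s0 t : 0 <= s t by exact/ltW/s_fun_gt0.
move=> y; rewrite expr0 mul1r normrM !ger0_norm//.
by rewrite ler_piMr ?s_fun_le1.
Qed.

Lemma integral_s_conv x : \int[mu]_y (s y * s (x - y)) = 2 * xc x.
Proof.
have pi0 : pi != 0 by rewrite gt_eqF// pi_gt0.
have q0 : expR (- (2 * pi * y)) @[y --> +oo] --> 0.
  by apply: cvgy_expR_Npi; rewrite mulr_gt0 ?pi_gt0.
have qE y : expR (- (2 * pi * y)) = expR (- (pi * y)) / expR (pi * y).
  by rewrite -expRB; congr expR; ring.
(* The general antiderivative divides by sinh(pi x); at x = 0 the integrand is s^2, the derivative
   of h / pi. *)
have [->|x0] := eqVneq x 0.
  pose F t := pi^-1 * h t.
  have dF t : is_derive t (1 : R) F (s t * s (0 - t)).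
    apply: is_derive_eq (is_deriveZ _ (is_derive_h_fun t)) _.
    rewrite /GRing.scale/= sub0r s_funN; move: pi0; generalize pi => p p0.
    by field.
  have hl : h y @[y --> +oo] --> (1 : R).
    have -> : h = (fun y => (1 - expR (- (2 * pi * y))) / (1 + expR (- (2 * pi * y)))).
      apply/funext => y; rewrite qE expRN /h_fun /Defs.sinh /Defs.cosh expRN.
      have e0 := expR_gt0 (pi * y); set e := expR _ in e0 *; clearbody e.
      by field; rewrite !gt_eqF ?addr_gt0 ?mulr_gt0.
    rewrite [X in _ --> X](_ : _ = (1 - 0) / (1 + 0)); last by rewrite subr0 addr0 divr1.
    apply: cvgM; first by apply: cvgB => //; exact: cvg_cst.
    by apply: cvgV; [rewrite addr0|apply: cvgD => //; exact: cvg_cst].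
  rewrite (@integralT_FTC _ _ F pi^-1 (- pi^-1) _ _ dF).
  - by rewrite /xc_fun eqxx; ring.
  - exact: continuous_s_conv.
  - exact: rintegrable_s_conv.
  - by rewrite -[X in _ --> X]mulr1; apply: cvgMr.
  - rewrite -[X in _ --> - X]mulr1 -mulrN /F; apply: cvgMr.
    by under eq_fun do rewrite h_funN; exact: cvgN.
have S0 := sinh_pi_neq0 x0.
pose c := (pi * sinh (pi * x))^-1.
(* Its derivative is c pi (h(y) + h(x - y)), so [h_fun_add] dictates the value of [c]. *)
pose F y := c * (ln (cosh (pi * y)) - ln (cosh (pi * (x - y)))).
have dF y : is_derive y (1 : R) F (s y * s (x - y)).
  have d1 := is_derive1_comp (f := @ln R) (g := fun u => cosh (pi * u))
     (is_derive1_ln (cosh_gt0 _)) (is_derive_cosh_pi y).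
  have d2 : is_derive y (1 : R) (fun u => x - u) (- 1).
    have := is_deriveB (is_derive_cst x y (1 : R)) (is_derive_id y (1 : R)).
    by move=> d; apply: is_derive_eq d _; rewrite sub0r.
  have d3 := is_derive1_comp (f := fun u => cosh (pi * u)) (g := fun u => x - u)
     (is_derive_cosh_pi (x - y)) d2.
  have d4 := is_derive1_comp (f := @ln R) (g := fun u => cosh (pi * (x - u)))
     (is_derive1_ln (cosh_gt0 (pi * (x - y)))) d3.
  apply: is_derive_eq (is_deriveZ c (is_deriveB d1 d4)) _.
  have := h_fun_add x y; rewrite /GRing.scale/= /c /h_fun.
  move: S0; set S := sinh (pi * x) => S0 H.
  transitivity (S^-1 * (sinh (pi * y) / cosh (pi * y) + sinh (pi * (x - y)) / cosh (pi * (x - y)))).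
    have := cosh_neq0 (pi * y); have := cosh_neq0 (pi * (x - y)) => C1 C2.
    move: (cosh _) (cosh _) C1 C2 => c1 c2 C1 C2; move: pi0.
    generalize (sinh (pi * y)) (sinh (pi * (x - y))) pi => s1 s2 p p0.
    by clearbody S; field; rewrite p0 S0 C1 C2.
  by rewrite H mulKf.
pose b := expR (pi * x).
have b0 : 0 < b by exact: expR_gt0.
(* One limit for both ends: dividing the quotient of the two cosh by e^(pi y) / 2 above and below
   gives this form, with d = e^(- pi x) at plus infinity and d = e^(pi x) at minus infinity. *)
have lnl (d : R) : 0 < d -> ln ((1 + expR (- (2 * pi * y))) /
    (d + d^-1 * expR (- (2 * pi * y)))) @[y --> +oo] --> ln d^-1.
  move=> d0.
  have L : (1 + expR (- (2 * pi * y))) / (d + d^-1 * expR (- (2 * pi * y))) @[y --> +oo]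
     --> (1 + 0) / (d + d^-1 * 0).
    apply: cvgM; first by apply: cvgD => //; exact: cvg_cst.
    apply: cvgV; first by rewrite mulr0 addr0 gt_eqF.
    by apply: cvgD; [exact: cvg_cst|exact: cvgMr].
  move: L; rewrite mulr0 !addr0 mul1r => L.
  by apply: (cvg_comp _ _ L); apply: continuous_ln; rewrite invr_gt0.
rewrite (@integralT_FTC _ _ F (c * (pi * x)) (c * - (pi * x)) _ _ dF).
- rewrite -mulrBr opprK /c /xc_fun (negbTE x0).
  move: pi0 S0; generalize (sinh (pi * x)) => S; generalize pi => p p0 S0.
  by field; rewrite p0 S0.
- exact: continuous_s_conv.
- exact: rintegrable_s_conv.
- rewrite /F; apply: cvgMr.
  have -> : (fun y => ln (cosh (pi * y)) - ln (cosh (pi * (x - y)))) =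
    (fun y => ln ((1 + expR (- (2 * pi * y))) /
       (b^-1 + b^-1^-1 * expR (- (2 * pi * y))))).
    apply/funext => y; rewrite -ln_div ?posrE ?cosh_gt0//; congr ln.
    rewrite qE /Defs.cosh (_ : pi * (x - y) = pi * x - pi * y); last by ring.
    rewrite opprB !expRB -/b !expRN.
    have e0 := expR_gt0 (pi * y); set e := expR _ in e0 *; clearbody e b.
    by field; rewrite !gt_eqF ?addr_gt0 ?mulr_gt0.
  have := lnl b^-1; rewrite invr_gt0 invrK => /(_ b0).
  by rewrite /b expRK.
- rewrite /F; apply: cvgMr.
  have -> : (fun y => ln (cosh (pi * - y)) - ln (cosh (pi * (x - - y)))) =
    (fun y => ln ((1 + expR (- (2 * pi * y))) /
       (b + b^-1 * expR (- (2 * pi * y))))).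
    apply/funext => y; rewrite -ln_div ?posrE ?cosh_gt0//; congr ln.
    rewrite qE /Defs.cosh (_ : pi * (x - - y) = pi * x + pi * y); last by ring.
    rewrite mulrN opprK opprD !expRD -/b !expRN -/b.
    have e0 := expR_gt0 (pi * y); set e := expR _ in e0 *; clearbody e b.
    by field; rewrite !gt_eqF ?addr_gt0 ?mulr_gt0.
  by have := lnl b b0; rewrite lnV ?posrE// /b expRK.
Qed.

Lemma continuous_x_s_conv x : continuous (fun y => y * (s y * s (x - y))).
Proof. by move=> y; apply: cvgM; [exact: cvg_id|exact: continuous_s_conv]. Qed.

Lemma rintegrable_x_s_conv x : rintegrable (fun y => y * (s y * s (x - y))).
Proof.
have s0 t : 0 <= s t by exact/ltW/s_fun_gt0.
apply: (@rintegrable_le_s_fun 1) => [|y]; first exact: continuous_x_s_conv.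
rewrite expr1 !normrM [`|s y|]ger0_norm ?[`|s (x - y)|]ger0_norm//.
apply: ler_pM => //; first by rewrite mulr_ge0.
  by rewrite lerDr.
by rewrite ler_piMr ?s_fun_le1.
Qed.

(* The substitution y -> x - y turns the integral I into x * 2 xc(x) - I. *)
Lemma integral_x_s_conv x : \int[mu]_y (y * (s y * s (x - y))) = x * xc x.
Proof.
pose f y := y * (s y * s (x - y)).
have intf : rintegrable f by exact: rintegrable_x_s_conv.
have E := Rintegral_rsubr x (@continuous_x_s_conv x).
have : \int[mu]_y f (x - y) = x * (2 * xc x) - \int[mu]_y f y.
  rewrite -integral_s_conv -RintegralZl//; last exact: rintegrable_s_conv.
  rewrite -RintegralB//; last first.
    exact: (integrableZl measurableT x (rintegrable_s_conv x)).
  apply: eq_Rintegral => y _; rewrite /f subKr; ring.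
rewrite -/f in E *; rewrite -E; set I := Rintegral _ _ _ => H.
lra.
Qed.

End HyperbolicIntegrals.

(** * The span of the monomials x^a h^b s^c with c > 0 *)

Section Span.
Variable R : realType.
Implicit Types (t x y : R) (f g : R -> R[i]) (z : R[i]).
Local Notation s := (@s_fun R).
Local Notation h := (@h_fun R).
Local Notation pi := (@pi R).
Local Notation normc := Normc.normc.

Definition mono (a b c : nat) : R -> R[i] :=
  fun t => (t ^+ a * h t ^+ b * s t ^+ c)%:C.

Lemma monoX a b c t : mono a.+1 b c t = t%:C * mono a b c t.
Proof. by rewrite /mono -rmorphM exprS; congr (_%:C); move: (h t) (s t) => *; ring. Qed.

Lemma mono_h a b c t : mono a b.+1 c t = (h t)%:C * mono a b c t.
Proof.
by rewrite /mono -rmorphM [h t ^+ b.+1]exprS; congr (_%:C); move: (h t) (s t) => *; ring.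
Qed.

Lemma mono_s a b c t : mono a b c.+1 t = (s t)%:C * mono a b c t.
Proof.
by rewrite /mono -rmorphM [s t ^+ c.+1]exprS; congr (_%:C); move: (h t) (s t) => *; ring.
Qed.

Lemma mono000 t : mono 0 0 0 t = 1.
Proof. by rewrite /mono !expr0 !mul1r. Qed.

Lemma mono_hh a b c t : mono a b.+2 c t = mono a b c t - mono a b c.+2 t.
Proof.
have E : h t ^+ b.+2 = h t ^+ b * (1 - s t ^+ 2) by rewrite -h_fun_sqr -exprD addn2.
rewrite /mono -rmorphB E; congr (_%:C).
by rewrite -[c.+2]addn2 [s t ^+ (c + 2)]exprD; move: (h t) (s t) => *; ring.
Qed.

Lemma is_derive_Xn (f : R -> R) (n : nat) (t d : R) : is_derive t (1 : R) f d ->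
  is_derive t (1 : R) (fun u => f u ^+ n) (n%:R * f t ^+ n.-1 * d).
Proof.
move=> fd; elim: n => [|n IH].
  by rewrite !mul0r; exact: is_derive_cst.
under eq_fun do rewrite exprS.
apply: is_derive_eq (is_deriveM fd IH) _.
rewrite /GRing.scale/= [RHS]mulrAC -[n.+1]addn1 natrD.
by case: n {IH} => [|n] /=; rewrite ?exprS ?expr0; ring.
Qed.

(** From h' = pi s^2 and s' = - pi s h. Truncation in [a.-1] and [b.-1] is harmless, since the
    coefficients [a%:R] and [b%:R] vanish there. *)
Lemma is_cderiv_mono a b c : is_cderiv (mono a b c.+1) (fun t =>
  a%:R * mono a.-1 b c.+1 t + (b%:R * pi%:C) * mono a b.-1 c.+3 t
   + (- c.+1%:R * pi%:C) * mono a b.+1 c.+1 t).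
Proof.
have d t : is_derive t (1 : R) (fun u => u ^+ a * h u ^+ b * s u ^+ c.+1)
   (a%:R * (t ^+ a.-1 * h t ^+ b * s t ^+ c.+1) +
    b%:R * pi * (t ^+ a * h t ^+ b.-1 * s t ^+ c.+3) +
    - c.+1%:R * pi * (t ^+ a * h t ^+ b.+1 * s t ^+ c.+1)).
  have d1 := is_derive_Xn a (is_derive_id t (1 : R)).
  have d2 := is_derive_Xn b (is_derive_h_fun t).
  have d3 := is_derive_Xn c.+1 (is_derive_s_fun t).
  apply: is_derive_eq (is_deriveM (is_deriveM d1 d2) d3) _.
  rewrite /GRing.scale/= !fctE !exprS.
  move: (h t ^+ b) (h t ^+ b.-1) (t ^+ a) (t ^+ a.-1) (s t ^+ c) (h t) (s t) (c.+1%:R).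
  by generalize pi => p *; ring.
apply: is_cderiv_ext (is_cderiv_real d) _ => t.
by rewrite /mono !(rmorphD, rmorphM, rmorphN, rmorph_nat) /=.
Qed.

(* This is Sigma_C, presented by monomials in x, h and s. *)
Inductive hspan : set (R -> R[i]) :=
| hspan_mono a b c : hspan (mono a b c.+1)
| hspanD f g : hspan f -> hspan g -> hspan (fun t => f t + g t)
| hspanZ z f : hspan f -> hspan (fun t => z * f t).

Lemma hspan_ext f g : hspan f -> f =1 g -> hspan g.
Proof. by move=> hf /funext <-. Qed.

(** A single factor s absorbs the growth of t^a; h and the other powers of s are bounded by 1. *)
Lemma normc_mono_le a b c : exists M, forall t, normc (mono a b c.+1 t) <= M.
Proof.
have [M sM] := s_fun_decay R a; exists M => t; apply: le_trans (sM t).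
have s0 := ltW (s_fun_gt0 t).
rewrite normc_real !normrM !normrX exprS mulrA [`|s t|]ger0_norm//.
apply: (@le_trans _ _ (`|t| ^+ a * s t)); last first.
  by rewrite ler_wpM2r// lerXn2r ?nnegrE ?addr_ge0// lerDr.
rewrite -[leRHS]mulr1; apply: ler_pM => //.
- by rewrite !mulr_ge0// exprn_ge0.
- exact: exprn_ge0.
- rewrite ler_wpM2r// ler_piMr ?exprn_ge0// exprn_ile1// normr_h_fun_le1//.
- by rewrite exprn_ile1// s_fun_le1.
Qed.

Lemma rapid_hspan : rapid_module hspan.
Proof.
split.
- by apply: (hspan_ext (hspanZ 0 (hspan_mono 0 0 0))) => t; rewrite mul0r.
- exact: hspanD.
- exact: hspanZ.
- move=> f; elim=> [a b c|{}f g _ IHf _ IHg|z {}f _ IH].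
  + by apply: (hspan_ext (hspan_mono a.+1 b c)) => t; rewrite monoX.
  + by apply: (hspan_ext (hspanD IHf IHg)) => t; rewrite mulrDr.
  + by apply: (hspan_ext (hspanZ z IH)) => t; rewrite mulrCA.
- move=> f; elim=> [a b c|{}f g _ [f' df hf'] _ [g' dg hg']|z {}f _ [f' df hf']].
  + eexists; first exact: is_cderiv_mono.
    by do 2 ?apply: hspanD; apply: hspanZ; exact: hspan_mono.
  + by eexists; [exact: is_cderivD df dg|exact: hspanD].
  + by eexists; [exact: is_cderivZ df|exact: hspanZ].
- move=> f; elim=> [a b c|{}f g _ [M fM] _ [N gN]|z {}f _ [M fM]].
  + exact: normc_mono_le.
  + by exists (M + N) => t; apply: le_trans (le_normcD _ _) _; exact: lerD.
  + by exists (normc z * M) => t; rewrite Normc.normcM ler_wpM2l ?normc_ge0.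
Qed.

(** The accompanying monomial is the accumulator: a Horner step q X + z raises its exponent. The
    next two lemmas repeat this for h and s, each handling coefficients by the previous one. *)
Lemma hspan_horner1 (q : {poly R[i]}) a b c :
  hspan (fun t => q.[t%:C] * mono a b c.+1 t).
Proof.
elim/poly_ind: q a => [|q z IH] a.
  by apply: (hspan_ext (hspanZ 0 (hspan_mono 0 0 0))) => t; rewrite horner0 !mul0r.
apply: (hspan_ext (hspanD (IH a.+1) (hspanZ z (hspan_mono a b c)))) => t.
by rewrite hornerMXaddC monoX; ring.
Qed.

Lemma hspan_horner2 (q : {poly {poly R[i]}}) b c :
  hspan (fun t => q.[(h t)%:C%:P].[t%:C] * mono 0 b c.+1 t).
Proof.
elim/poly_ind: q b => [|q z IH] b.
  by apply: (hspan_ext (hspanZ 0 (hspan_mono 0 0 0))) => t; rewrite !horner0 !mul0r.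
apply: (hspan_ext (hspanD (IH b.+1) (hspan_horner1 z 0 b c))) => t.
by rewrite hornerMXaddC hornerD hornerM hornerC mono_h; ring.
Qed.

Lemma hspan_horner3 (q : {poly {poly {poly R[i]}}}) c :
  hspan (fun t => q.[(s t)%:C%:P%:P].[(h t)%:C%:P].[t%:C] * mono 0 0 c.+1 t).
Proof.
elim/poly_ind: q c => [|q z IH] c.
  by apply: (hspan_ext (hspanZ 0 (hspan_mono 0 0 0))) => t; rewrite !horner0 !mul0r.
apply: (hspan_ext (hspanD (IH c.+1) (hspan_horner2 z 0 c))) => t.
by rewrite hornerMXaddC !hornerD !hornerM !hornerC [mono _ _ c.+2 _]mono_s; ring.
Qed.

Lemma Sigma_C_hspan : @Sigma_C R = hspan.
Proof.
apply/seteqP; split=> [f [p [p0 ->]]|f].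
  elim/poly_ind: p p0 => [_|q z _].
    apply: (hspan_ext (hspanZ 0 (hspan_mono 0 0 0))) => t.
    by rewrite !horner0 mul0r.
  (* A vanishing constant term reduces the polynomial to q X, and X evaluated at [s] supplies the
     factor s that every monomial of [hspan] contains. *)
  rewrite coefD coefMX coefC /= add0r => ->; rewrite addr0.
  apply: (hspan_ext (hspan_horner3 q 0)) => t.
  by rewrite !hornerM hornerX !hornerC mono_s mono000 mulr1.
elim=> [a b c|{}f g _ [p [p0 ->]] _ [q [q0 ->]]|z {}f _ [p [p0 ->]]].
- exists ((('X^a)%:P * 'X^b)%:P * 'X^(c.+1)); split.
    by rewrite coefMXn.
  apply/funext => t; rewrite !(hornerM, hornerC, hornerXn) -!polyC_exp !hornerC.
  by rewrite /mono 2!rmorphM 3!rmorphXn.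
- exists (p + q); split; first by rewrite coefD p0 q0 addr0.
  by apply/funext => t; rewrite !hornerD.
- exists (z%:P%:P%:P * p); split; first by rewrite coefCM p0 mulr0.
  by apply/funext => t; rewrite !hornerM !hornerC.
Qed.

(** Products are immediate for polynomials, derivatives for monomials; [Sigma_C_hspan] moves between
    the two presentations. *)
Lemma hspan_mul f g : hspan f -> hspan g -> hspan (fun t => f t * g t).
Proof.
rewrite -Sigma_C_hspan => -[p [p0 ->]] [q [q0 ->]].
exists (p * q); split; first by rewrite coef0M p0 mul0r.
by apply/funext => t; rewrite !hornerM.
Qed.

(* As a module over the Weyl algebra, the span is generated by s and s^2, since
   h s^n = - (s^n)' / (n pi), (s^n)'' = pi^2 (n^2 s^n - n (n + 1) s^(n+2)) and
   h^2 = 1 - s^2. *)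
Lemma hspan_weyl_ind (P : (R -> R[i]) -> Prop) :
  (forall f g, hspan f -> hspan g -> P f -> P g -> P (fun t => f t + g t)) ->
  (forall z f, hspan f -> P f -> P (fun t => z * f t)) ->
  (forall f, hspan f -> P f -> P (fun t => t%:C * f t)) ->
  (forall f, hspan f -> P f -> P (cderiv f)) ->
  P (mono 0 0 1) -> P (mono 0 0 2) -> forall f, hspan f -> P f.
Proof.
move=> PD PZ PX Pd P1 P2.
have pi0 : pi%:C != 0 :> R[i].
  by rewrite eq_complex /= negb_and gt_eqF// pi_gt0.
have Pext f g : P f -> f =1 g -> P g by move=> Pf /funext <-.
have P01 n : P (mono 0 0 n.+1) -> P (mono 0 1 n.+1).
  move=> Pn; have hn := hspan_mono 0 0 n.
  have := PZ (- n.+1%:R * pi%:C)^-1 _ (rapid_cderiv rapid_hspan hn) (Pd _ hn Pn).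
  move/Pext; apply => t.
  rewrite (is_cderiv_cderiv (is_cderiv_mono 0 0 n)) !mul0r !add0r mulKf//.
  by rewrite mulf_neq0// oppr_eq0 pnatr_eq0.
have P02 n : P (mono 0 0 n.+1) -> P (mono 0 0 n.+3).
  move=> Pn; have P1n := P01 _ Pn.
  have h0 := hspan_mono 0 0 n; have h1 := hspan_mono 0 1 n.
  have Q1 := Pd _ h1 P1n; have H1 := rapid_cderiv rapid_hspan h1.
  (* With m = n + 1, (h s^m)' = pi (m + 1) s^(m+2) - pi m s^m; adding pi m s^m isolates s^(m+2). *)
  have := PZ (pi%:C * n.+2%:R)^-1 _ (hspanD H1 (hspanZ (n.+1%:R * pi%:C) h0))
     (PD _ _ H1 (hspanZ (n.+1%:R * pi%:C) h0) Q1 (PZ _ _ h0 Pn)).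
  move/Pext; apply => t.
  rewrite (is_cderiv_cderiv (is_cderiv_mono 0 1 n)) !mul0r !add0r.
  have n0 : pi%:C * n.+2%:R != 0 :> R[i] by rewrite mulf_neq0// pnatr_eq0.
  apply: (mulfI n0); rewrite mulVKf//.
  rewrite mono_hh -[n.+2%:R]natr1 -[1.-1]/0%N.
  move: (mono 0 0 n.+1 t) (mono 0 0 n.+3 t); move: (pi%:C) (n.+1%:R : R[i]) => *.
  ring.
have Ps n : P (mono 0 0 n.+1) /\ P (mono 0 0 n.+2).
  by elim: n => // n [IH1 IH2]; split => //; exact: P02.
(* Consecutive b are kept together, for all n at once, because h^(b+2) s^m = h^b s^m - h^b s^(m+2)
   lowers b by two and raises the power of s. *)
have Ph b n : P (mono 0 b n.+1) /\ P (mono 0 b.+1 n.+1).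
  elim: b n => [|b IH] n; first by have [Pn _] := Ps n; split => //; exact: P01.
  split; first by have [] := IH n.
  have [Pb _] := IH n; have [Pb2 _] := IH n.+2.
  have hb := hspan_mono 0 b n; have hb2 := hspanZ (-1) (hspan_mono 0 b n.+2).
  have := PD _ _ hb hb2 Pb (PZ (-1) _ (hspan_mono 0 b n.+2) Pb2).
  move/Pext; apply => t.
  by rewrite mono_hh mulN1r.
have Pm a b n : P (mono a b n.+1).
  elim: a => [|a IH]; first by have [] := Ph b n.
  apply: (Pext _ _ (PX _ (hspan_mono a b n) IH)) => t.
  by rewrite monoX.
move=> f; elim=> [a b c|{}f g hf Pf hg Pg|z {}f hf Pf].
- exact: Pm.
- exact: PD.
- exact: PZ.
Qed.

End Span.

(** * The Fourier transform of sech *)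

Section LinearODE.
Variable R : realType.

(* Gronwall's argument for the energy w^2 + w'^2. *)
Lemma linear_ode2_eq0 (w w1 q : R -> R) (K : R) :
  (forall x, is_derive x (1 : R) w (w1 x)) ->
  (forall x, is_derive x (1 : R) w1 (q x * w x)) ->
  (forall x, `|q x| <= K) -> w 0 = 0 -> w1 0 = 0 ->
  forall x, 0 <= x -> w x = 0.
Proof.
move=> dw dw1 qK w0 w10 x x0.
(* The energy has derivative 2 (1 + q) w w', at most (1 + K) times the energy; this rate makes [G]
   nonincreasing, and [G] is nonnegative and starts at 0. *)
pose G x := (w x * w x + w1 x * w1 x) * expR (- ((1 + K) * x)).
pose G' x := ((w x * w1 x + w1 x * w x) + (w1 x * (q x * w x) + q x * w x * w1 x)
   - (1 + K) * (w x * w x + w1 x * w1 x)) * expR (- ((1 + K) * x)).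
have dG y : is_derive y (1 : R) G (G' y).
  have dE : is_derive y (1 : R) (fun u => expR (- ((1 + K) * u)))
      (- (1 + K) * expR (- ((1 + K) * y))).
    have dl : is_derive y (1 : R) (fun u => - ((1 + K) * u)) (- (1 + K)).
      apply: is_derive_eq (is_deriveN (is_deriveZ (1 + K) (is_derive_id y (1 : R)))) _.
      by rewrite /GRing.scale/= mulr1.
    have := is_derive1_comp (f := @expR R) (g := fun u => - ((1 + K) * u))
      (is_derive_expR _) dl.
    by rewrite mulrC.
  have := is_deriveM (is_deriveD (is_deriveM (dw y) (dw y)) (is_deriveM (dw1 y) (dw1 y))) dE.
  move=> d; apply: is_derive_eq d _.
  by rewrite /GRing.scale/= !fctE /G'; move: (expR _) => e; ring.
have G'0 y : G' y <= 0.
  rewrite /G'; have := expR_gt0 (- ((1 + K) * y)); move: (expR _) => e e0.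
  rewrite pmulr_lle0//; have := qK y; rewrite ler_norml => /andP[q1 q2].
  move: (w y) (w1 y) (q y) q1 q2 => a b c c1 c2.
  have := sqr_ge0 (a - b); have := sqr_ge0 (a + b); have := sqr_ge0 a; have := sqr_ge0 b.
  rewrite !expr2; have [c3|c3] := leP 0 (1 + c); nra.
have Gx : G x <= G 0.
  apply: (@ler0_derive1_nincry _ G 0) => //.
  - by move=> y _; rewrite derive1E; have [_ ->] := dG y.
  - apply: continuous_subspaceT => y.
    by apply/differentiable_continuous/derivable1_diffP; have [] := dG y.
have G0 : G 0 = 0 by rewrite /G w0 w10 !mul0r addr0 mul0r.
move: Gx; rewrite G0 /G pmulr_lle0 ?expR_gt0// => H.
apply/eqP; rewrite -sqrf_eq0 expr2 eq_le; apply/andP; split; last by rewrite -expr2 sqr_ge0.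
by apply: le_trans H; rewrite lerDl -expr2 sqr_ge0.
Qed.

End LinearODE.

Section FourierSech.
Variable R : realType.
Implicit Types (t x y k xi : R) (f g : R -> R[i]) (z : R[i]).
Let mu := @lebesgue_measure R.
Local Notation Re := complex.Re.
Local Notation Im := complex.Im.
Local Notation s := (@s_fun R).
Local Notation h := (@h_fun R).
Local Notation xc := (@xc_fun R).
Local Notation pi := (@pi R).
Local Notation tau := (tau R).
Local Notation normc := Normc.normc.
Local Notation sC := (fun t => (s t)%:C).
Local Notation xcC := (fun t => (xc t)%:C).

Lemma tame_le_s_fun n (f : R -> R) : continuous f ->
  (forall t, `|f t| <= (1 + `|t|) ^+ n * s t) -> tame (fun t => (f t)%:C).
Proof.
move=> cf fs; split; first exact/ccontinuous_measurable/ccontinuous_real.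
have [M sM] := s_fun_decay R n.+2; exists M => t; apply: le_trans (sM t).
rewrite normc_real.
apply: (@le_trans _ _ ((1 + `|t|) ^+ 2 * ((1 + `|t|) ^+ n * s t))); last first.
  by rewrite mulrA -exprD add2n.
apply: ler_pM => //; first exact/ltW/oneDsqr_gt0.
exact: oneDsqr_le_normr.
Qed.

Lemma continuous_oneDsqr_mul (f : R -> R) : continuous f ->
  continuous (fun t => (1 + t ^+ 2) * f t).
Proof. by move=> cf t; apply: cvgM; [exact: (@continuous_oneDsqr R)|exact: cf]. Qed.

Lemma tame_s_fun : tame sC.
Proof.
apply: (@tame_le_s_fun 0); first exact: continuous_s_fun.
by move=> t; rewrite mul1r ger0_norm// ltW// s_fun_gt0.
Qed.

Lemma tame_xc_fun : tame xcC.
Proof.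
apply: (@tame_le_s_fun 1); first exact: continuous_xc_fun.
by move=> t; rewrite ger0_norm ?xc_fun_le// ltW// xc_fun_gt0.
Qed.

Lemma tame_oneDsqr_s : tame (fun t => (1 + t ^+ 2)%:C * sC t).
Proof.
under eq_fun do rewrite -rmorphM.
apply: (@tame_le_s_fun 2); first exact/continuous_oneDsqr_mul/continuous_s_fun.
move=> t; have t0 := oneDsqr_gt0 t; have x0 := s_fun_gt0 t.
rewrite ger0_norm; last by rewrite mulr_ge0// ltW.
by rewrite ler_pM2r// oneDsqr_le_normr.
Qed.

Lemma tame_oneDsqr_xc : tame (fun t => (1 + t ^+ 2)%:C * xcC t).
Proof.
under eq_fun do rewrite -rmorphM.
apply: (@tame_le_s_fun 3); first exact/continuous_oneDsqr_mul/continuous_xc_fun.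
move=> t; have t0 := oneDsqr_gt0 t; have x0 := xc_fun_gt0 t.
rewrite ger0_norm; last by rewrite mulr_ge0// ltW.
rewrite [X in _ <= X * _]exprSr -[X in _ <= X]mulrA.
by apply: ler_pM; rewrite ?oneDsqr_le_normr ?xc_fun_le// ltW.
Qed.

Lemma ccontinuous_s_fun : ccontinuous sC.
Proof. exact/ccontinuous_real/continuous_s_fun. Qed.

Lemma conv_s_s : conv sC sC = (fun x => 2 * xcC x).
Proof.
apply/funext => x; rewrite /conv.
under eq_cintegral do rewrite -rmorphM.
by rewrite cintegral_real integral_s_conv rmorphM rmorph_nat.
Qed.

Lemma FT_xc_fun k : FT k (fun x => 2 * xcC x) = (fun xi => FT k sC xi * FT k sC xi).
Proof.
rewrite -conv_s_s FT_conv//; [exact: tame_oneDsqr_s|by have [] := tame_s_fun|exact: tame_s_fun|].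
exact: ccontinuous_s_fun.
Qed.

Lemma FT_at0 k f : FT k f 0 = cintegral f.
Proof.
apply: eq_cintegral => x; rewrite mulr0 (_ : cis 0 = 1) ?mul1r//.
by apply: complex_ext; rewrite /= ?cos0 ?sin0.
Qed.

(** At frequency 0 the transform is the integral, so F (2 x c) = (F s)^2 reads 2 I = 1. *)
Lemma integral_xc_fun : \int[mu]_t xc t = 2^-1.
Proof.
have := congr1 (fun f => f 0) (FT_xc_fun 1); rewrite /= !FT_at0 cintegral_real integral_s_fun mulr1.
rewrite cintegralZ ?cintegral_real; last exact: (tame_integrable tame_xc_fun).
set I := Rintegral _ _ _ => H.
have /complexI E : (2 * I)%:C = 1%:C by rewrite rmorphM rmorph_nat.
by apply: (@mulfI _ 2) => //; rewrite E mulfV.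
Qed.

Lemma integral_xc_conv_s x : \int[mu]_y (xc y * s (x - y)) = (4^-1 + x ^+ 2) * s x.
Proof.
have c2 : continuous (fun y => xc (2 * y)).
  move=> y; apply: (@continuous_comp _ _ _ (fun y => 2 * y) xc); last exact: continuous_xc_fun.
  by apply: cvgMr; exact: cvg_id.
have i2 : rintegrable (fun y => xc (2 * y)).
  apply: (@rintegrable_le_s_fun _ 1) => // y; rewrite expr1.
  (* This is [xc_fun_mul_s_fun] at x = 0, where the two tanh cancel. *)
  have -> : xc (2 * y) = xc y * s y.
    by have := xc_fun_mul_s_fun 0 y; rewrite sub0r s_funN h_funN subrr mulr0 addr0 s_fun0 mul1r.
  rewrite ger0_norm; last by rewrite mulr_ge0// ltW ?xc_fun_gt0 ?s_fun_gt0.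
  apply: le_trans (xc_fun_le y); rewrite ler_piMr ?s_fun_le1//.
  by rewrite ltW// xc_fun_gt0.
have i1 := rintegrable_x_s_conv x.
have E1 : \int[mu]_y xc (2 * y) = 4^-1.
  have : \int[mu]_y xc y = \int[mu]_y (xc (2 * y) * 2).
    rewrite (Rintegral_affine 0 (ltr0n R 2) (@continuous_xc_fun R)).
    by apply: eq_Rintegral => y _; rewrite addr0.
  rewrite integral_xc_fun RintegralZr// => E.
  by apply: (@mulIf _ 2) => //; rewrite -E; field.
transitivity (\int[mu]_y (s x * (xc (2 * y) + sinh (pi * x) * (y * (s y * s (x - y)))))).
  apply: eq_Rintegral => y _; rewrite xc_fun_mul_s_fun h_fun_add; congr (_ * (_ + _)).
  by rewrite mulrCA.
have i3 := integrableZl measurableT (sinh (pi * x)) i1.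
rewrite RintegralZl//; last exact: (integrableD measurableT i2 i3).
rewrite RintegralD// RintegralZl// E1 integral_x_s_conv mulrC; congr ((_ + _) * _).
(* What remains is sinh(pi x) (x xc(x)) = x^2, the origin of the quadratic term. *)
have [->|x0] := eqVneq x 0; first by rewrite mul0r mulr0 expr0n.
rewrite /xc_fun (negbTE x0) expr2; have := sinh_pi_neq0 x0.
by move: (sinh _) => S S0; field.
Qed.

Lemma conv_xc_s : conv xcC sC = (fun x => ((4^-1 + x ^+ 2) * s x)%:C).
Proof.
apply/funext => x; rewrite /conv.
under eq_cintegral do rewrite -rmorphM.
by rewrite cintegral_real integral_xc_conv_s.
Qed.

Lemma mono001 : @mono R 0 0 1 = sC.
Proof. by apply/funext => t; rewrite mono_s mono000 mulr1. Qed.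

Lemma hspan_s_fun : hspan sC.
Proof. by rewrite -mono001; exact: hspan_mono. Qed.

Lemma tame_Xn_s n : tame (fun t => (t ^+ n)%:C * sC t).
Proof. exact/(rapid_tame (@rapid_hspan R))/(rapid_Xn (@rapid_hspan R))/hspan_s_fun. Qed.

(* The Fourier transform of s * s * s = (1/2 + 2 x^2) s (convolution powers); it
   is the differential equation g'' = pi^2 (g - 2 g^3) for g = FT s. *)
Lemma FT_s_cube k xi : 2^-1 * FT k sC xi + 2 * FT k (fun t => (t ^+ 2)%:C * sC t) xi =
  FT k sC xi ^+ 3.
Proof.
have tx2 := tame_Xn_s 2; have ts := tame_s_fun.
have := congr1 (fun f => f xi) (FT_xc_fun k); rewrite /= FTZ; last exact: tame_xc_fun.
have := congr1 (fun f => f xi) (FT_conv k tame_oneDsqr_xc (proj1 tame_xc_fun) ts ccontinuous_s_fun).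
rewrite /= conv_xc_s.
have -> : (fun x => ((4^-1 + x ^+ 2) * s x)%:C) =
    (fun x => 4^-1 * sC x + (x ^+ 2)%:C * sC x).
  apply/funext => x; rewrite rmorphM rmorphD mulrDl; congr (_ * _ + _).
  by rewrite fmorphV rmorph_nat.
rewrite (FTD k (tameZ 4^-1 ts) tx2) (FTZ k 4^-1 ts).
move: (FT k sC xi) (FT k (fun t => (t ^+ 2)%:C * sC t) xi) (FT k xcC xi).
move=> a b c H1 H2.
transitivity (2 * (4^-1 * a + b)); first by field.
by rewrite H1 mulrA H2; ring.
Qed.

Lemma FT_s_opp k xi : FT k sC (- xi) = FT k sC xi.
Proof.
have <- : FT (- k) sC xi = FT k sC (- xi).
  by apply: eq_cintegral => x; rewrite mulrN !mulNr.
rewrite -FT_oppr; last exact: ccontinuous_s_fun.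
by apply: eq_cintegral => x; rewrite s_funN.
Qed.

(** The imaginary part integrates a sine against the even function s, and reflection turns this
    integral into its negative. *)
Lemma Im_FT_s k xi : Im (FT k sC xi) = 0.
Proof.
rewrite /FT /cintegral /=; set f := fun x => _.
have fE : f = (fun x => sin (k * x * xi) * s x).
  by apply/funext => x; rewrite /f mulr0 add0r.
have cf : continuous f.
  rewrite fE => x; apply: cvgM; last exact: continuous_s_fun.
  have := ccontinuous_cis (k * xi) => -[_ /= /(_ x)].
  by rewrite /continuous_at; under eq_fun do rewrite mulrAC; rewrite mulrAC.
have intf : rintegrable f.
  apply: (@rintegrable_le_s_fun _ 0) => // x; rewrite fE expr0 mul1r normrM.
  have s0 := ltW (s_fun_gt0 x).
  by rewrite [`|s x|]ger0_norm// ler_piMl ?sin_max.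
have := Rintegral_oppr cf.
have -> : (fun x => f (- x)) = (fun x => -1 * f x).
  apply/funext => x; rewrite fE s_funN (_ : k * - x * xi = - (k * x * xi)); last by ring.
  by rewrite sinN mulN1r mulNr.
rewrite RintegralZl// mulN1r => /eqP; rewrite -subr_eq0 opprK -mulr2n mulrn_eq0 /=.
by move/eqP.
Qed.

Lemma is_derive2_s_fun t : is_derive t (1 : R) (fun u => - pi * (s u * h u))
  (pi ^+ 2 * (s t - 2 * s t ^+ 3)).
Proof.
apply: is_derive_eq (is_deriveZ (- pi) (is_deriveM (is_derive_s_fun t) (is_derive_h_fun t))) _.
rewrite /GRing.scale/=; have := h_fun_sqr t.
move: (s t) (h t) => a b H; move: pi => p.
have -> : b * (- p * (a * b)) = - p * a * b ^+ 2 by ring.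
by rewrite H; ring.
Qed.

Lemma FT_s_fun : FT tau sC = sC.
Proof.
pose f1 t := (0 +i* tau) * (t%:C * sC t).
have hs := hspan_s_fun; have rh := @rapid_hspan R.
have h1 : hspan f1 by exact/hspanZ/(rapidX rh).
have h2 : hspan (fun t => t%:C * f1 t) by exact: (rapidX rh).
have x1 : hspan (fun t => t%:C * sC t) by exact: (rapidX rh).
have d1 : is_cderiv (FT tau sC) (FT tau f1).
  exact: (FT_mulX tau (rapid_tame rh hs) (rapid_tame rh x1)).
have d2 := FT_mulX tau (rapid_tame rh h1) (rapid_tame rh h2).
pose u x := Re (FT tau sC x); pose u1 x := Re (FT tau f1 x).
have gE x : FT tau sC x = (u x)%:C.
  by apply: complex_ext => //; rewrite Im_FT_s.
have du x : is_derive x (1 : R) u (u1 x) by have [] := d1 x.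
have du1 x : is_derive x (1 : R) u1 (pi ^+ 2 * (u x - 2 * u x ^+ 3)).
  have [d _] := d2 x; apply: is_derive_eq d _.
  have -> : (fun t => (0 +i* tau) * (t%:C * f1 t)) =
      (fun t => (- tau ^+ 2)%:C * ((t ^+ 2)%:C * sC t)).
    have ii : (0 +i* tau) * (0 +i* tau) = (- tau ^+ 2)%:C.
      by apply: complex_ext => /=; ring.
    by apply/funext => t; rewrite /f1 -ii expr2 rmorphM /=; ring.
  rewrite FTZ; last exact: tame_Xn_s.
  have := FT_s_cube tau x; rewrite gE; move: (FT _ _ _) => b H.
  (* [FT_s_cube] solved for the transform of t^2 s; the factor - tau^2 = - 4 pi^2 then yields u'' =
     pi^2 (u - 2 u^3). *)
  have -> : b = ((u x ^+ 3 - 2^-1 * u x) / 2)%:C.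
    move: (u x) H => a H.
    rewrite rmorphM /= rmorphB /= rmorphXn /= [(2^-1 * a)%:C]rmorphM /= !fmorphV /= !rmorph_nat -H.
    by field.
  by rewrite complex_ReM /= mulr0 subr0 /Defs.tau; move: pi (u x) => p a; field.
have [M uM] := FT_bounded tau tame_s_fun.
have {}uM x : `|u x| <= M by apply: le_trans (uM x); exact: normr_Re_le.
have M0 : 0 <= M by apply: le_trans (uM 0).
have sM t : `|s t| <= 1 by rewrite ger0_norm ?s_fun_le1// ltW// s_fun_gt0.
(* Subtracting the equations for u and s and factoring u^3 - s^3 makes the difference a solution of
   a linear equation with this coefficient. *)
pose q x := pi ^+ 2 * (1 - 2 * (u x ^+ 2 + u x * s x + s x ^+ 2)).
have qK x : `|q x| <= pi ^+ 2 * (1 + 2 * (M ^+ 2 + M * 1 + 1 ^+ 2)).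
  rewrite normrM [`|pi ^+ 2|]ger0_norm ?sqr_ge0// ler_wpM2l ?sqr_ge0//.
  apply: (le_trans (ler_normB _ _)); rewrite normr1 lerD2l normrM ger0_norm// ler_wpM2l//.
  apply: (le_trans (ler_normD _ _)); apply: lerD; last first.
    by rewrite normrX lerXn2r// ?nnegrE.
  apply: (le_trans (ler_normD _ _)); apply: lerD.
    by rewrite normrX lerXn2r// ?nnegrE.
  by rewrite normrM; apply: ler_pM.
have H x : 0 <= x -> u x - s x = 0.
  apply: (@linear_ode2_eq0 _ (fun x => u x - s x)
    (fun x => u1 x - (- pi * (s x * h x))) q) qK _ _ x.
  - by move=> y; have a := du y; have b := is_derive_s_fun y; exact: is_deriveB.
  - move=> y; have a := du1 y; have b := is_derive2_s_fun y.
    apply: is_derive_eq (is_deriveB a b) _.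
    by rewrite /q; move: (u y) (s y) pi => A B p; ring.
  - by rewrite /u FT_at0 cintegral_real integral_s_fun s_fun0 subrr.
  (* At frequency 0 the integrand i tau t s(t) is purely imaginary, so the real part of its integral
     vanishes. *)
  - rewrite h_fun0 !mulr0 subr0 /u1 FT_at0 /cintegral /=.
    rewrite (_ : (fun x => _) = (fun=> 0)) ?Rintegral_cst//= ?mul0r//.
    by apply/funext => x; rewrite mul0r mulr0 mul0r addr0 mulr0 subr0.
apply/funext => x; rewrite gE; congr (_%:C).
have {}H y : 0 <= y -> u y = s y by move/H/eqP; rewrite subr_eq0 => /eqP.
(* The energy estimate covers x >= 0; both functions are even. *)
have [/H//|/ltW x0] := leP 0 x.
by rewrite -s_funN -H ?oppr_ge0// /u FT_s_opp.
Qed.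

Lemma FTN_s_fun : FT (- tau) sC = sC.
Proof.
rewrite -[in RHS]FT_s_fun; apply/funext => x; rewrite -FT_oppr; last exact: ccontinuous_s_fun.
by apply: eq_cintegral => y; rewrite s_funN.
Qed.

End FourierSech.

(** * Inversion on the hyperbolic spaces, and the doublets *)

Section Inversion.
Variable R : realType.
Implicit Types (t x y k xi : R) (f g : R -> R[i]) (z : R[i]).
Local Notation s := (@s_fun R).
Local Notation h := (@h_fun R).
Local Notation xc := (@xc_fun R).
Local Notation pi := (@pi R).
Local Notation tau := (tau R).
Local Notation sC := (fun t => (s t)%:C).
Local Notation xcC := (fun t => (xc t)%:C).
Local Notation rh := (@rapid_hspan R).

Lemma tau_neq0 : tau != 0.
Proof. by rewrite mulf_neq0 ?pnatr_eq0// gt_eqF// pi_gt0. Qed.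

Lemma imag_neq0 k : k != 0 -> (0 +i* k) != 0 :> R[i].
Proof. by move=> k0; rewrite eq_complex /= negb_and k0 orbT. Qed.

Lemma mono002 : @mono R 0 0 2 = (fun t => sC t * sC t).
Proof. by apply/funext => t; rewrite 2!mono_s mono000 mulr1. Qed.

Lemma FTN_s_sqr : FT (- tau) (fun t => sC t * sC t) = (fun x => 2 * xcC x).
Proof.
have := conv_FT tau (@tame_s_fun R) (@tame_s_fun R).
by rewrite FTN_s_fun FT_s_fun conv_s_s => ->.
Qed.

Lemma rapid_FTN_hspan : rapid_module (FT (- tau) @` @hspan R).
Proof. by apply: (rapid_FT rh); rewrite oppr_eq0 tau_neq0. Qed.

Lemma FT_FTN f : hspan f -> FT tau (FT (- tau) f) = f.
Proof.
(* The inner transforms themselves form a rapid module, so the rules for x and d/dx also apply to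
   the outer transform. *)
have rF := rapid_FTN_hspan.
have ik0 : (0 +i* (- tau)) != 0 :> R[i] by rewrite imag_neq0// oppr_eq0 tau_neq0.
have ikN : 0 +i* (- tau) = - (0 +i* tau) :> R[i].
  by apply: complex_ext => /=; rewrite ?oppr0.
have im f1 : hspan f1 -> (FT (- tau) @` @hspan R) (FT (- tau) f1) by move=> hf; exists f1.
elim/hspan_weyl_ind => [{}f g hf hg Ef Eg|z {}f hf Ef|{}f hf Ef|{}f hf Ef||].
- rewrite FTD; [|exact: (rapid_tame rh)..].
  by rewrite FTD ?Ef ?Eg//; apply: (rapid_tame rF); exact: im.
- rewrite FTZ; last exact: (rapid_tame rh).
  by rewrite FTZ ?Ef//; apply: (rapid_tame rF); exact: im.
- have E : FT (- tau) (fun t => t%:C * f t) =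
      (fun xi => (0 +i* (- tau))^-1 * cderiv (FT (- tau) f) xi).
    by rewrite (cderiv_FT rh)//; apply/funext => xi; rewrite mulKf.
  rewrite E FTZ; last by apply/(rapid_tame rF)/(rapid_cderiv rF)/im.
  rewrite (FT_cderiv rF); last exact: im.
  by rewrite Ef; apply/funext => xi; rewrite -ikN mulKf.
- rewrite (FT_cderiv rh)//.
  have hX := rapidX rF (im _ hf).
  rewrite FTZ; last exact: (rapid_tame rF).
  have := cderiv_FT rF tau (im _ hf); rewrite Ef => ->.
  by apply/funext => xi; rewrite ikN opprK.
- by rewrite mono001 FTN_s_fun FT_s_fun.
- by rewrite mono002 FTN_s_sqr FT_xc_fun FT_s_fun.
Qed.

Lemma S_C_FT : @S_C R = FT (- tau) @` @hspan R.
Proof.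
rewrite /S_C Sigma_C_hspan; apply/seteqP; split => _ [f hf <-]; exists f => //.
  by rewrite fourier_inv_FT.
by rewrite fourier_inv_FT.
Qed.

Lemma rapid_S_C : rapid_module (@S_C R).
Proof. by rewrite S_C_FT; exact: rapid_FTN_hspan. Qed.

Lemma rapid_Sigma_C : rapid_module (@Sigma_C R).
Proof. by rewrite Sigma_C_hspan; exact: rh. Qed.

Lemma fourier_S_C f : S_C f -> Sigma_C (fourier f).
Proof.
by rewrite S_C_FT Sigma_C_hspan => -[g hg <-]; rewrite fourierE FT_FTN.
Qed.

Lemma fourier_S_C_inj f g : S_C f -> S_C g -> fourier f = fourier g -> f = g.
Proof.
rewrite S_C_FT => -[f1 hf <-] [g1 hg <-]; rewrite !fourierE.
by rewrite !FT_FTN// => ->.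
Qed.

Lemma fourier_S_C_surj f : Sigma_C f -> exists2 g, S_C g & fourier g = f.
Proof.
rewrite S_C_FT Sigma_C_hspan => hf; exists (FT (- tau) f); first by exists f.
by rewrite fourierE FT_FTN.
Qed.

(** Writing g = F^v b, [conv_FT] gives f * g = F^v (F f . b), and F f . b is in Sigma' because that
    space is closed under products. Membership follows at once, and [FT_FTN] gives the transform. *)
Lemma conv_S_C f g : S_C f -> S_C g ->
  S_C (conv f g) /\ fourier (conv f g) = pmul (fourier f) (fourier g).
Proof.
move=> Sf; rewrite S_C_FT => -[b hb <-].
have tf := rapid_tame rapid_S_C Sf.
have hFf : hspan (fourier f) by rewrite -Sigma_C_hspan; exact: fourier_S_C.
have hm := hspan_mul hFf hb.
rewrite conv_FT//; last exact: (rapid_tame rh).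
split; first by eexists; [exact: hm|].
rewrite [fourier (FT (- tau) b)]fourierE (FT_FTN hb) [LHS]fourierE.
exact: (FT_FTN hm).
Qed.

Lemma fourierD f g : S_C f -> S_C g -> fourier (f \+ g) = fourier f \+ fourier g.
Proof.
by move=> Sf Sg; rewrite fourierE (FTD tau (rapid_tame rapid_S_C Sf) (rapid_tame rapid_S_C Sg)).
Qed.

Lemma fourierZ z f : S_C f -> fourier (z \*o f) = z \*o fourier f.
Proof. by move=> Sf; rewrite fourierE (FTZ tau z (rapid_tame rapid_S_C Sf)). Qed.

Lemma pmul_Sigma_C f g : Sigma_C f -> Sigma_C g -> Sigma_C (pmul f g).
Proof. by rewrite Sigma_C_hspan; exact: hspan_mul. Qed.

Lemma regular_doublet_C : regular_doublet (fun z : R[i] => z) (@S_C R) (@Sigma_C R).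
Proof.
split; first split.
- split; [exact: (rapid_schwartz rapid_S_C)|exact: (rapid0 rapid_S_C)
    |exact: (rapidD rapid_S_C)|exact: (rapidZ rapid_S_C)|].
  by move=> f g Sf Sg; have [] := conv_S_C Sf Sg.
- split; [exact: (rapid_schwartz rapid_Sigma_C)|exact: (rapid0 rapid_Sigma_C)
    |exact: (rapidD rapid_Sigma_C)|exact: (rapidZ rapid_Sigma_C)|exact: pmul_Sigma_C].
- split; [exact: fourier_S_C|exact: fourierD|by move=> a f; exact: fourierZ|].
  by move=> f g Sf Sg; have [] := conv_S_C Sf Sg.
- split; [exact: fourier_S_C| |].
    by move=> f g /set_mem Sf /set_mem Sg; exact: fourier_S_C_inj.
  by move=> f /fourier_S_C_surj[g Sg <-]; exists g.
Qed.

Lemma wact_pmul f g : Sigma_C f -> Sigma_C g ->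
  wact (WD R) (pmul f g) = pmul (wact (WD R) f) g \+ pmul f (wact (WD R) g) /\
  wact (WX R) (pmul f g) = pmul (wact (WX R) f) g.
Proof.
move=> Sf Sg; split; apply/funext => t; rewrite /pmul /=; last by rewrite mulrA.
have df := rapid_is_cderiv rapid_Sigma_C Sf; have dg := rapid_is_cderiv rapid_Sigma_C Sg.
rewrite (is_cderiv_cderiv (is_cderivM df dg)) /=.
by move: (f t) (g t) (cderiv f t) (cderiv g t) => a b c d; ring.
Qed.

Lemma fourier_wact_S_C T f : S_C f -> fourier (wact T f) = wact (wfourier T) (fourier f).
Proof. exact: (fourier_wact rapid_S_C). Qed.

(** Instead of differentiating the convolution integral, both identities are checked after F, which
    is injective on S'. There D becomes the scalar - x and x becomes the derivation D of the
    pointwise product. *)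
Lemma wact_conv f g : S_C f -> S_C g ->
  wact (WD R) (conv f g) = conv (wact (WD R) f) g /\
  wact (WX R) (conv f g) = conv (wact (WX R) f) g \+ conv f (wact (WX R) g).
Proof.
move=> Sf Sg; have [Sfg Ffg] := conv_S_C Sf Sg.
have w T f1 : S_C f1 -> S_C (wact T f1) by exact: (rapid_wact rapid_S_C).
have Ff := fourier_S_C Sf; have Fg := fourier_S_C Sg.
have [S1 E1] := conv_S_C (w (WD R) _ Sf) Sg.
have [S2 E2] := conv_S_C (w (WX R) _ Sf) Sg.
have [S3 E3] := conv_S_C Sf (w (WX R) _ Sg).
split; apply: fourier_S_C_inj => //; try exact: w.
- rewrite E1 !fourier_wact_S_C// Ffg.
  by apply/funext => t; rewrite /pmul /= !mulrA.
- exact: (rapidD rapid_S_C).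
- rewrite fourierD// E2 E3 !fourier_wact_S_C// Ffg.
  by have [-> _] := wact_pmul Ff Fg.
Qed.

Lemma compatible_weyl_action_C : compatible_weyl_action (@S_C R) (@Sigma_C R).
Proof.
split; [exact: (rapid_weyl_submodule rapid_S_C)|exact: (rapid_weyl_submodule rapid_Sigma_C)
  |exact: wact_pmul|exact: wact_conv|exact: fourier_wact_S_C].
Qed.

(** * The real doublet *)

Lemma Sigma_R_ind (P : (R -> R[i]) -> Prop) :
  (forall f g, P f -> P g -> P (fun t => f t + g t)) ->
  (forall (a : R) f, P f -> P (fun t => a%:C * f t)) ->
  (forall n, P (mono 0 0 n.+1)) -> forall f, Sigma_R f -> P f.
Proof.
move=> PD PZ Pm _ [p [p0 ->]].
have Pext f g : P f -> f =1 g -> P g by move=> Pf /funext <-.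
have H (q : {poly R}) c : P (fun t => (q.[s t])%:C * mono 0 0 c.+1 t).
  elim/poly_ind: q c => [|q a IH] c.
    by apply: (Pext _ _ (PZ 0 _ (Pm 0%N))) => t; rewrite horner0 !mul0r.
  apply: (Pext _ _ (PD _ _ (IH c.+1) (PZ a _ (Pm c)))) => t.
  rewrite hornerMXaddC [mono _ _ c.+2 _]mono_s rmorphD /= [(q.[s t] * s t)%:C]rmorphM /=.
  by move: (q.[_])%:C (s t)%:C (mono _ _ _ _) => *; ring.
elim/poly_ind: p p0 => [_|q a _].
  by apply: (Pext _ _ (PZ 0 _ (Pm 0%N))) => t; rewrite horner0 mul0r.
rewrite coefD coefMX coefC /= add0r => ->; rewrite addr0.
apply: (Pext _ _ (H q 0%N)) => t.
by rewrite hornerMX [(q.[s t] * s t)%:C]rmorphM /= mono_s mono000 mulr1.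
Qed.

Lemma Sigma_R_subset : @Sigma_R R `<=` @Sigma_C R.
Proof.
rewrite Sigma_C_hspan; apply: Sigma_R_ind => [f g|a f|n].
- exact: hspanD.
- exact: hspanZ.
- exact: hspan_mono.
Qed.

Lemma Sigma_RD f g : Sigma_R f -> Sigma_R g -> Sigma_R (f \+ g).
Proof.
move=> [p [p0 ->]] [q [q0 ->]]; exists (p + q); split; first by rewrite coefD p0 q0 addr0.
by apply/funext => t /=; rewrite hornerD rmorphD.
Qed.

Lemma Sigma_RZ (a : R) f : Sigma_R f -> Sigma_R (a%:C \*o f).
Proof.
move=> [p [p0 ->]]; exists (a *: p); split; first by rewrite coefZ p0 mulr0.
by apply/funext => t /=; rewrite hornerZ rmorphM.
Qed.

Lemma Sigma_RM f g : Sigma_R f -> Sigma_R g -> Sigma_R (pmul f g).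
Proof.
move=> [p [p0 ->]] [q [q0 ->]]; exists (p * q); split; first by rewrite coef0M p0 mul0r.
by apply/funext => t; rewrite hornerM rmorphM.
Qed.

Lemma Sigma_R0 : @Sigma_R R (fun=> 0).
Proof. by exists 0; split; [rewrite coef0|apply/funext => t; rewrite horner0]. Qed.

Lemma Sigma_R_mono n : Sigma_R (@mono R 0 0 n.+1).
Proof.
exists ('X^(n.+1)); split; first by rewrite coefXn.
by apply/funext => t; rewrite hornerXn /mono !expr0 !mul1r.
Qed.

Lemma is_cderiv_mono_s n : is_cderiv (@mono R 0 0 n.+1)
  (fun t => (- n.+1%:R * pi%:C) * mono 0 1 n.+1 t).
Proof.
by apply: is_cderiv_ext (is_cderiv_mono 0 0 n) _ => t; rewrite !mul0r !add0r.
Qed.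

Lemma is_cderiv2_mono_s n : is_cderiv (fun t => (- n.+1%:R * pi%:C) * @mono R 0 1 n.+1 t)
  (fun t => (pi ^+ 2)%:C * (n.+1%:R ^+ 2 * mono 0 0 n.+1 t
                            - n.+1%:R * n.+2%:R * mono 0 0 n.+3 t)).
Proof.
apply: is_cderiv_ext (is_cderivZ _ (is_cderiv_mono 0 1 n)) _ => t.
rewrite mul0r add0r mono_hh -[n.+2%:R]natr1 -[1.-1]/0%N [(pi ^+ 2)%:C]rmorphXn /=.
move: (mono 0 0 n.+1 t) (mono 0 0 n.+3 t); move: (pi%:C) (n.+1%:R : R[i]) => *.
ring.
Qed.

Lemma tau_pi : (- tau ^- 2) * pi ^+ 2 = - 4^-1.
Proof.
rewrite /Defs.tau; have := gt_eqF (pi_gt0 R) => /negbT.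
by move: pi => p p0; field.
Qed.

Lemma Sigma_R_cderiv2 f : Sigma_R f ->
  Sigma_R (fun t => (- tau ^- 2)%:C * cderiv (cderiv f) t).
Proof.
(* The induction carries the derivatives as witnesses, since the rules for sums and multiples need
   differentiability and not only the value of [cderiv]. *)
suff H : forall f, Sigma_R f -> exists f1 f2, [/\ is_cderiv f f1, is_cderiv f1 f2 &
    Sigma_R (fun t => (- tau ^- 2)%:C * f2 t)].
  by move=> /H[f1 [f2 [/is_cderiv_cderiv -> /is_cderiv_cderiv ->]]].
apply: Sigma_R_ind => [{}f g [f1 [f2 [df df1 Sf]]] [g1 [g2 [dg dg1 Sg]]]
  |a {}f [f1 [f2 [df df1 Sf]]]|n].
- exists (fun t => f1 t + g1 t), (fun t => f2 t + g2 t).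
  split; [exact: is_cderivD|exact: is_cderivD|].
  have -> : (fun t => (- tau ^- 2)%:C * (f2 t + g2 t)) =
     (fun t => (- tau ^- 2)%:C * f2 t) \+ (fun t => (- tau ^- 2)%:C * g2 t).
    by apply/funext => t /=; rewrite mulrDr.
  exact: Sigma_RD.
- exists (fun t => a%:C * f1 t), (fun t => a%:C * f2 t).
  split; [exact: is_cderivZ|exact: is_cderivZ|].
  have -> : (fun t => (- tau ^- 2)%:C * (a%:C * f2 t)) =
     a%:C \*o (fun t => (- tau ^- 2)%:C * f2 t).
    by apply/funext => t /=; rewrite mulrCA.
  exact: Sigma_RZ.
- do 2 eexists; split; [exact: is_cderiv_mono_s|exact: is_cderiv2_mono_s|].
  have -> : (fun t => (- tau ^- 2)%:C * ((pi ^+ 2)%:C *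
      (n.+1%:R ^+ 2 * mono 0 0 n.+1 t - n.+1%:R * n.+2%:R * mono 0 0 n.+3 t))) =
    (- 4^-1 * n.+1%:R ^+ 2)%:C \*o mono 0 0 n.+1 \+
    (4^-1 * (n.+1%:R * n.+2%:R))%:C \*o mono 0 0 n.+3.
    apply/funext => t /=; rewrite mulrA -rmorphM tau_pi /=.
    move: (mono 0 0 n.+1 t) (mono 0 0 n.+3 t) => a b.
    have E1 : (- 4^-1)%:C = - 4^-1 :> R[i] by rewrite rmorphN fmorphV rmorph_nat.
    have -> : (- 4^-1 * n.+1%:R ^+ 2)%:C = - 4^-1 * n.+1%:R ^+ 2 :> R[i].
      by rewrite rmorphM rmorphXn /= rmorph_nat E1.
    have -> : (4^-1 * (n.+1%:R * n.+2%:R))%:C = 4^-1 * (n.+1%:R * n.+2%:R) :> R[i].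
      by rewrite !rmorphM fmorphV /= !rmorph_nat.
    rewrite E1; move: (n.+1%:R : R[i]) (n.+2%:R : R[i]) (4^-1 : R[i]) => *; ring.
  by apply: Sigma_RD; apply: Sigma_RZ; exact: Sigma_R_mono.
Qed.

Lemma fourier_X2 f : S_C f -> fourier (fun t => (t ^+ 2)%:C * f t) =
  (fun xi => (- tau ^- 2)%:C * cderiv (cderiv (fourier f)) xi).
Proof.
move=> Sf; have rS := rapid_S_C.
have S1 := rapidX rS Sf; have S2 := rapidX rS S1.
have S1Z := rapidZ rS (0 +i* tau) S1.
rewrite !fourierE (cderiv_FT rS)// -(FTZ _ _ (rapid_tame rS S1)) (cderiv_FT rS)//.
have -> : (fun t => t%:C * ((0 +i* tau) * (t%:C * f t))) =
    (fun t => (0 +i* tau) * ((t ^+ 2)%:C * f t)).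
  by apply/funext => t; rewrite expr2 rmorphM /=; ring.
rewrite (FTZ _ _ (rapid_tame rS (rapid_Xn rS 2 Sf))).
apply/funext => xi; rewrite !mulrA.
have -> : (- tau ^- 2)%:C * (0 +i* tau) * (0 +i* tau) = 1 :> R[i].
  by apply: complex_ext => /=; have := tau_neq0; move: tau => k k0; field.
by rewrite mul1r.
Qed.

Lemma S_RD f g : S_R f -> S_R g -> S_R (f \+ g).
Proof.
move=> [p1 [q1 ->]] [p2 [q2 ->]]; exists (p1 + p2), (q1 + q2).
apply/funext => t /=; rewrite -rmorphD !hornerD !mulrDl; congr (_%:C).
by rewrite addrACA.
Qed.

Lemma S_RZ (a : R) f : S_R f -> S_R (a%:C \*o f).
Proof.
move=> [p [q ->]]; exists (a *: p), (a *: q).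
by apply/funext => t /=; rewrite -rmorphM !hornerZ mulrDr !mulrA.
Qed.

Lemma S_RX2 f : S_R f -> S_R (fun t => (t ^+ 2)%:C * f t).
Proof.
move=> [p [q ->]]; exists (p * 'X), (q * 'X).
apply/funext => t /=; rewrite -rmorphM !hornerMX mulrDr; congr ((_ + _)%:C).
  by rewrite mulrA [_ * _ ^+ 2]mulrC.
by rewrite mulrA [_ * _ ^+ 2]mulrC.
Qed.

Lemma S_R_s : S_R sC.
Proof.
exists 1, 0; apply/funext => t.
by rewrite horner0 hornerC mul1r mul0r addr0.
Qed.

Lemma S_R_xc : S_R xcC.
Proof.
exists 0, 1; apply/funext => t.
by rewrite horner0 hornerC mul1r mul0r add0r.
Qed.

Lemma S_C_s : S_C sC.
Proof. by rewrite S_C_FT; exists sC; [exact: hspan_s_fun|exact: FTN_s_fun]. Qed.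

Lemma S_C_xc : S_C xcC.
Proof.
have hs := hspan_s_fun R; have h2 := hspan_mul hs hs.
have := rapidZ rapid_S_C 2^-1 (f := fun x => 2 * xcC x).
have -> : (fun t => 2^-1 * (2 * xcC t)) = xcC.
  by apply/funext => t; rewrite mulKf// pnatr_eq0.
by apply; rewrite S_C_FT -FTN_s_sqr; exists (fun t => sC t * sC t).
Qed.

Lemma fourier_s_fun : fourier sC = sC.
Proof. by rewrite fourierE FT_s_fun. Qed.

Lemma fourier_xc_fun : fourier (fun x => 2 * xcC x) = (fun x => sC x * sC x).
Proof. by rewrite fourierE FT_xc_fun FT_s_fun. Qed.

Lemma S_R_ind (P : (R -> R[i]) -> Prop) :
  (forall f g, P f -> P g -> P (fun t => f t + g t)) ->
  (forall (a : R) f, P f -> P (fun t => a%:C * f t)) ->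
  (forall f, P f -> P (fun t => (t ^+ 2)%:C * f t)) ->
  P sC -> P xcC -> forall f, S_R f -> P f.
Proof.
move=> PD PZ PX Ps Pxc _ [p [q ->]].
have Pext f g : P f -> f =1 g -> P g by move=> Pf /funext <-.
have H b (r : {poly R}) : P b -> P (fun t => (r.[t ^+ 2])%:C * b t).
  move=> Pb; elim/poly_ind: r => [|r a IH].
    by apply: (Pext _ _ (PZ 0 _ Pb)) => t; rewrite horner0.
  apply: (Pext _ _ (PD _ _ (PX _ IH) (PZ a _ Pb))) => t.
  rewrite hornerMXaddC rmorphD /= [(r.[_] * _)%:C]rmorphM /=.
  by move: (r.[_])%:C (t ^+ 2)%:C (b t) => *; ring.
apply: (Pext _ _ (PD _ _ (H _ p Ps) (H _ q Pxc))) => t.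
by rewrite rmorphD /= [(p.[_] * _)%:C]rmorphM [(q.[_] * _)%:C]rmorphM.
Qed.

Lemma S_R_subset : @S_R R `<=` @S_C R.
Proof.
apply: S_R_ind; [exact: (rapidD rapid_S_C)|by move=> a; exact: (rapidZ rapid_S_C)| |
  exact: S_C_s|exact: S_C_xc].
by move=> f; exact: (rapid_Xn rapid_S_C).
Qed.

Lemma fourier_S_R f : S_R f -> Sigma_R (fourier f).
Proof.
(* Membership in S' is carried along because the rules for F are stated on S'. *)
move=> Sf; suff [] : S_C f /\ Sigma_R (fourier f) by [].
elim/S_R_ind: Sf => [{}f g [Sf Ff] [Sg Fg]|a {}f [Sf Ff]|{}f [Sf Ff]||].
- split; first exact: (rapidD rapid_S_C).
  by rewrite (fourierD Sf Sg); exact: Sigma_RD.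
- split; first exact: (rapidZ rapid_S_C).
  by rewrite (fourierZ _ Sf); exact: Sigma_RZ.
- split; first exact: (rapid_Xn rapid_S_C).
  by rewrite fourier_X2//; exact: Sigma_R_cderiv2.
- split; first exact: S_C_s.
  by rewrite fourier_s_fun -mono001; exact: Sigma_R_mono.
- split; first exact: S_C_xc.
  have -> : xcC = (2^-1)%:C \*o (fun x => 2 * xcC x).
    by apply/funext => t /=; rewrite fmorphV rmorph_nat mulKf// pnatr_eq0.
  rewrite fourierZ; last exact: (rapidZ rapid_S_C _ S_C_xc).
  by apply: Sigma_RZ; rewrite fourier_xc_fun -mono002; exact: Sigma_R_mono.
Qed.

Lemma fourier_S_R_surj f : Sigma_R f -> exists2 g, S_R g & fourier g = f.
Proof.
move: f; apply: Sigma_R_ind => [f g [f1 Sf <-] [g1 Sg <-]|a f [f1 Sf <-]|n].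
- exists (f1 \+ g1); first exact: S_RD.
  by rewrite fourierD//; exact: S_R_subset.
- exists (a%:C \*o f1); first exact: S_RZ.
  by rewrite fourierZ//; exact: S_R_subset.
(* The recursion leads from s^m to s^(m+2), so two consecutive powers are kept; it starts from s = F
   s and s^2 = F (2 x c). *)
suff [] : (exists2 g, S_R g & fourier g = @mono R 0 0 n.+1) /\
          (exists2 g, S_R g & fourier g = @mono R 0 0 n.+2) by [].
elim: n => [|n [[g Sg Fg] IH]].
  split; first by exists sC; [exact: S_R_s|rewrite fourier_s_fun mono001].
  exists (2%:C \*o xcC); first exact/S_RZ/S_R_xc.
  by rewrite mono002 -fourier_xc_fun; congr fourier; apply/funext => t /=; rewrite rmorph_nat.
split=> //.
pose m : R := n.+1%:R.
(* If F g = s^m, then F (x^2 g) = - (1/4) (m^2 s^m - m (m + 1) s^(m+2)); solving for s^(m+2) gives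
   these coefficients. *)
exists ((4 / (m * n.+2%:R))%:C \*o (fun t => (t ^+ 2)%:C * g t) \+ (m / n.+2%:R)%:C \*o g).
  by apply: S_RD; [exact/S_RZ/S_RX2|exact: S_RZ].
have Cg := S_R_subset Sg; have Cg2 := rapid_Xn rapid_S_C 2 Cg.
rewrite fourierD; [|exact: (rapidZ rapid_S_C)..].
rewrite !fourierZ// fourier_X2// Fg.
rewrite (is_cderiv_cderiv (is_cderiv_mono_s n)) (is_cderiv_cderiv (is_cderiv2_mono_s n)).
apply/funext => t /=.
have T : (- tau ^- 2)%:C * (pi ^+ 2)%:C = - 4^-1 :> R[i].
  by rewrite -rmorphM tau_pi rmorphN fmorphV rmorph_nat.
rewrite [(- tau ^- 2)%:C * _]mulrA T /m.
move: (mono 0 0 n.+1 t) (mono 0 0 n.+3 t) => a b.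
have -> : (4 / (n.+1%:R * n.+2%:R))%:C = 4 / (n.+1%:R * n.+2%:R) :> R[i].
  by rewrite rmorphM fmorphV rmorphM /= !rmorph_nat.
have -> : (n.+1%:R / n.+2%:R)%:C = n.+1%:R / n.+2%:R :> R[i].
  by rewrite rmorphM fmorphV /= !rmorph_nat.
have : n.+1%:R != 0 :> R[i] by rewrite pnatr_eq0.
have : n.+2%:R != 0 :> R[i] by rewrite pnatr_eq0.
move: (n.+1%:R : R[i]) (n.+2%:R : R[i]) => x y y0 x0.
by field; rewrite x0 y0.
Qed.

Lemma regular_doublet_R : regular_doublet (fun r : R => r%:C) (@S_R R) (@Sigma_R R).
Proof.
split; first split.
- split.
  + by move=> f /S_R_subset; exact: (rapid_schwartz rapid_S_C).
  + exists 0, 0; apply/funext => t.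
    by rewrite horner0 !mul0r addr0.
  + exact: S_RD.
  + exact: S_RZ.
  (* The product F f . F g lies in Sigma, hence is F k for some k in S; injectivity of F on S'
     identifies k with the convolution. *)
  + move=> f g Sf Sg; have [Cfg E] := conv_S_C (S_R_subset Sf) (S_R_subset Sg).
    have [k Sk Fk] := fourier_S_R_surj (Sigma_RM (fourier_S_R Sf) (fourier_S_R Sg)).
    rewrite (fourier_S_C_inj Cfg (S_R_subset Sk))//.
    by rewrite E Fk.
- split; [|exact: Sigma_R0|exact: Sigma_RD|exact: Sigma_RZ|exact: Sigma_RM].
  by move=> f /Sigma_R_subset; exact: (rapid_schwartz rapid_Sigma_C).
- split; first exact: fourier_S_R.
  + by move=> f g /S_R_subset Sf /S_R_subset Sg; exact: fourierD.
  + by move=> a f /S_R_subset Sf; exact: fourierZ.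
  + by move=> f g /S_R_subset Sf /S_R_subset Sg; have [] := conv_S_C Sf Sg.
- split; [exact: fourier_S_R| |].
    move=> f g /set_mem/S_R_subset Sf /set_mem/S_R_subset Sg; exact: fourier_S_C_inj.
  by move=> f /fourier_S_R_surj[g Sg <-]; exists g.
Qed.

End Inversion.

Theorem proposition86 (R : realType) :
  [/\ regular_doublet (fun r : R => r%:C) (@S_R R) (@Sigma_R R),
      regular_doublet (fun z : R[i] => z) (@S_C R) (@Sigma_C R),
      @S_R R `<=` @S_C R,
      @Sigma_R R `<=` @Sigma_C R &
      compatible_weyl_action (@S_C R) (@Sigma_C R)].
Proof.
split.
- exact: regular_doublet_R.
- exact: regular_doublet_C.
- exact: S_R_subset.
- exact: Sigma_R_subset.
- exact: compatible_weyl_action_C.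
Qed.
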